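(* Let $S\subset\mathbb H^1$ be an oriented smooth surface with $T_pS\neq D_p$ for all $p\in S$, and let $U\subset S$ be an open set on which the horizontal normal can be written $\eta=\cos\alpha\,\mathbf e_1+\sin\alpha\,\mathbf e_2$ with $\alpha:U\to\mathbb R$ smooth. On $U$, the Gaussian curvature $K$ of $S$ (defined by the Gauss map) is given by $$K=\langle R(f_1,f_2)f_2,f_1\rangle=(dA\wedge d\alpha)(f_1,f_2),$$ where $R$ is the curvature tensor of the adapted covariant derivative $\nabla$ on $S$.
   Context: **Heisenberg group.** $\mathbb H^1=\mathbb R^3$ with product $(x_1,y_1,z_1)(x_2,y_2,z_2)=(x_1+x_2,\,y_1+y_2,\,z_1+z_2+\frac12(x_1y_2-x_2y_1))$. Left invariant fields: $\mathbf e_1=\partial_x-\frac12 y\,\partial_z$, $\mathbf e_2=\partial_y+\frac12 x\,\partial_z$, $\mathbf e_0=\partial_z=[\mathbf e_1,\mathbf e_2]$. The dual coframe is $\mathbf e^1=dx$, $\mathbf e^2=dy$, $\mathbf e^0=dz+\frac12(y\,dx-x\,dy)$. $D=\ker\mathbf e^0=\mathrm{span}(\mathbf e_1,\mathbf e_2)$, with the scalar product $\langle\,,\rangle$ making $\mathbf e_1,\mathbf e_2$ orthonormal; $J:D\to D$, $J(a\mathbf e_1+b\mathbf e_2)=-b\mathbf e_1+a\mathbf e_2$; $dV=\mathbf e^0\wedge\mathbf e^1\wedge\mathbf e^2$. Wedge convention: $(\omega\wedge\theta)(X,Y)=\omega(X)\theta(Y)-\omega(Y)\theta(X)$. **Surface.**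 $f_1$ is a smooth unit field spanning $D\cap TS$; the horizontal normal is $\eta=-Jf_1$; the horizontal conormal $\eta^*$ is the 1-form along $S$ with $\eta^*(\eta)=1$, $\eta^*|_{TS}=0$. Put $A=-\eta^*(\mathbf e_0)$ and $f_2=\mathbf e_0+A\eta$; then $(f_1,f_2)$ is a frame of $TS$. With $\eta=\cos\alpha\,\mathbf e_1+\sin\alpha\,\mathbf e_2$ one has $f_1=-\sin\alpha\,\mathbf e_1+\cos\alpha\,\mathbf e_2$. The element of area on $S$ is $dS=i(\eta)dV|_S$, and $S$ is oriented so that $dS$ is positive. **Gaussian curvature.** The Gauss map $g:S\to\mathbb H^1$ is $g(p)=(a,b,c)$ where $\eta^*(p)=a\,\mathbf e^1+b\,\mathbf e^2+c\,\mathbf e^0$ (that is, $g(p)=\exp(L_p^*\eta^*(p))$ after identifying the dual Lie algebra with the Lie algebra). It takes values in the cylinder $C=\{x^2+y^2=1\}$, whose horizontal normal is $\tilde\eta=x\mathbf e_1+y\mathbf e_2$. Then $$K(p)=\lim_{W\to\{p\}}\frac{\int_{g(W)}i(\tilde\eta)dV}{\int_W i(\eta)dV},$$ over neighbourhoods $W\subset S$ of $p$ shrinking to $p$, where the numerator is the signed area $\int_W g^*(i(\tilde\eta)dV)$. **Adapted derivative.** For $Y=\sum_{j=0}^2 b_j\mathbf e_j$, $\overline\nabla_XY=\sum_{j=0}^2 db_j(X)\mathbf e_j$. For $X,Y$ tangent to $S$, the adapted covariant derivative is $\nabla_XY=\overline\nabla_XY-\eta^*(\overline\nabla_XY)\eta$,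 a covariant derivative on $TS$. Its curvature tensor is $R(X,Y)Z=\nabla_X\nabla_YZ-\nabla_Y\nabla_XZ-\nabla_{[X,Y]}Z$; the vector $R(f_1,f_2)f_2$ lies in $D$, so the scalar product makes sense. *)

(* Defs.v *)
From HB Require Import structures.
From mathcomp Require Import all_boot all_order all_algebra.
From mathcomp Require Import all_classical all_reals all_analysis.

Set Implicit Arguments.
Unset Strict Implicit.
Unset Printing Implicit Defensive.

Import Order.TTheory GRing.Theory Num.Theory.
Import numFieldNormedType.Exports.

Local Open Scope classical_set_scope.
Local Open Scope ring_scope.

Section Smoothness.
Context {R : realType} {V W : normedModType R}.

(* For finite-dimensional V this is the usual class C^n on the open set O. *)
Fixpoint Ck (n : nat) (O : set V) (f : V -> W) : Prop :=
  match n with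
  | 0 => forall x, O x -> {for x, continuous f}
  | m.+1 => (forall x, O x -> differentiable f x) /\
            (forall v, Ck m O ('D_v f))
  end.

Definition smooth_on (O : set V) (f : V -> W) : Prop := forall n, Ck n O f.

End Smoothness.

Section Heisenberg.
Context {R : realType}.

(* Points of H^1 and tangent vectors at a point are both given by their
   coordinates (x, y, z), resp. by their components on d/dx, d/dy, d/dz. *)
Notation H1 := 'rV[R]_3.

Definition vec3 (x y z : R) : H1 := \row_(j < 3) [:: x; y; z]`_j.

Definition e0 (p : H1) : H1 := vec3 0 0 1.
Definition e1 (p : H1) : H1 := vec3 1 0 (- (p 0 1 / 2)).
Definition e2 (p : H1) : H1 := vec3 0 1 (p 0 0 / 2).
Definition frame (j : 'I_3) (p : H1) : H1 := [:: e0 p; e1 p; e2 p]`_j.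

Definition th0 (p v : H1) : R := v 0 2 + (p 0 1 * v 0 0 - p 0 0 * v 0 1) / 2.
Definition th1 (p v : H1) : R := v 0 0.
Definition th2 (p v : H1) : R := v 0 1.
Definition coframe (j : 'I_3) (p v : H1) : R :=
  [:: th0 p v; th1 p v; th2 p v]`_j.

Definition horizontal (p : H1) : set H1 := [set v | th0 p v = 0].

(* Only meaningful for v, w in [horizontal p]; likewise [J p v] below. *)
Definition hdot (p v w : H1) : R := th1 p v * th1 p w + th2 p v * th2 p w.

Definition J (p v : H1) : H1 := - th2 p v *: e1 p + th1 p v *: e2 p.

(* The volume form e^0 /\ e^1 /\ e^2. *)
Definition dV (p X Y Z : H1) : R :=
  \det (\matrix_(i < 3, j < 3) coframe i p [:: X; Y; Z]`_j).

Definition wedge (om th : H1 -> R) (X Y : H1) : R := om X * th Y - om Y * th X.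

End Heisenberg.

Section Surfaces.
Context {R : realType}.
Notation H1 := 'rV[R]_3.

Record chart := Chart { dom : set (R * R); par :> R * R -> H1 }.

Definition du (phi : chart) (q : R * R) : H1 := 'D_(1, 0) phi q.
Definition dv (phi : chart) (q : R * R) : H1 := 'D_(0, 1) phi q.

Definition rel_open (S U : set H1) : Prop := exists2 O, open O & U = S `&` O.

(* [par_inj] and [par_open] make phi a homeomorphism of its domain onto a
   relatively open subset of S. *)
Record parametrization (S : set H1) (phi : chart) : Prop := {
  par_dom : open (dom phi);
  par_smooth : smooth_on (dom phi) phi;
  par_immersion : forall q, dom phi q -> forall w, 'D_w phi q = 0 -> w = 0;
  par_inj : {in dom phi &, injective phi};
  par_open : forall O, open O -> O `<=` dom phi -> rel_open S (phi @` O) }.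

(* A smooth embedded surface S with an oriented atlas; [atlas_coherent] says
   that coordinate changes have positive Jacobian determinant. *)
Record oriented_surface (S : set H1) (atl : set chart) : Prop := {
  atlas_par : forall phi, atl phi -> parametrization S phi;
  atlas_cover : forall p, S p -> exists2 phi, atl phi & (phi @` dom phi) p;
  atlas_coherent : forall phi psi, atl phi -> atl psi ->
    forall q r, dom phi q -> dom psi r -> phi q = psi r ->
    forall a b c d : R,
      du psi r = a *: du phi q + b *: dv phi q ->
      dv psi r = c *: du phi q + d *: dv phi q ->
      0 < a * d - b * c }.

Variable atl : set chart.

Definition tangent (p : H1) : set H1 :=
  [set v | exists phi q w,
     [/\ atl phi, dom phi q, phi q = p & 'D_w phi q = v]].

(* Smoothness of a map given on the subset U of the surface (its values
   elsewhere are irrelevant). *)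
Definition smooth_along {W : normedModType R} (U : set H1) (h : H1 -> W) :
    Prop :=
  forall phi, atl phi -> smooth_on (dom phi `&` phi @^-1` U) (h \o phi).

(* The differential dh(v) at p of a map h on the surface, for v tangent at p,
   computed in a chart; for h smooth near p it does not depend on the chart,
   and it only involves the values of h on the surface near p. *)
Definition sdiff {W : normedModType R} (h : H1 -> W) (p v : H1) : W :=
  get [set r : W | exists phi q w,
    [/\ atl phi, dom phi q, phi q = p, 'D_w phi q = v
      & 'D_w (h \o phi) q = r]].

(* The vector field with components X(Y^i) - Y(X^i) on d/dx, d/dy, d/dz. *)
Definition lie_bracket (X Y : H1 -> H1) (p : H1) : H1 :=
  sdiff Y p (X p) - sdiff X p (Y p).

Definition flat_nabla (X Y : H1 -> H1) (p : H1) : H1 :=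
  \sum_(j < 3) sdiff (fun q => coframe j q (Y q)) p (X p) *: frame j p.

Definition nabla (eta : H1 -> H1) (conormal : H1 -> H1 -> R)
    (X Y : H1 -> H1) (p : H1) : H1 :=
  flat_nabla X Y p - conormal p (flat_nabla X Y p) *: eta p.

Definition curvature (eta : H1 -> H1) (conormal : H1 -> H1 -> R)
    (X Y Z : H1 -> H1) (p : H1) : H1 :=
  let D := nabla eta conormal in
  D X (D Y Z) p - D Y (D X Z) p - D (lie_bracket X Y) Z p.

(* f1 is a smooth unit field spanning the intersection of D and TS. *)
Record horizontal_unit_tangent (S : set H1) (f1 : H1 -> H1) : Prop := {
  hut_smooth : smooth_along S f1;
  hut_unit : forall p, S p -> hdot p (f1 p) (f1 p) = 1;
  hut_span : forall p, S p ->
    horizontal p `&` tangent p = [set v | exists t : R, v = t *: f1 p] }.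

Definition horizontal_normal (f1 : H1 -> H1) (p : H1) : H1 := - J p (f1 p).

Record is_conormal (S : set H1) (eta : H1 -> H1) (conormal : H1 -> H1 -> R) :
    Prop := {
  conormal_scalar : forall p, S p -> scalar (conormal p);
  conormal_eta : forall p, S p -> conormal p (eta p) = 1;
  conormal_tangent : forall p v, S p -> tangent p v -> conormal p v = 0 }.

Definition coefA (conormal : H1 -> H1 -> R) (p : H1) : R :=
  - conormal p (e0 p).

Definition second_field (eta : H1 -> H1) (conormal : H1 -> H1 -> R) (p : H1) :
    H1 :=
  e0 p + coefA conormal p *: eta p.

Definition area_form (eta : H1 -> H1) (p X Y : H1) : R := dV p (eta p) X Y.

Definition area_positive (eta : H1 -> H1) : Prop :=
  forall phi q, atl phi -> dom phi q ->
    0 < area_form eta (phi q) (du phi q) (dv phi q).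

(* (a, b, c) where conormal = a e^1 + b e^2 + c e^0. *)
Definition gauss_map (conormal : H1 -> H1 -> R) (p : H1) : H1 :=
  vec3 (conormal p (e1 p)) (conormal p (e2 p)) (conormal p (e0 p)).

(* The horizontal normal of the cylinder x^2 + y^2 = 1. *)
Definition cylinder_normal (c : H1) : H1 := c 0 0 *: e1 c + c 0 1 *: e2 c.

(* The pullback by the Gauss map of the area form of the cylinder. *)
Definition gauss_area_form (conormal : H1 -> H1 -> R) (p X Y : H1) : R :=
  let g := gauss_map conormal in
  area_form cylinder_normal (g p) (sdiff g p X) (sdiff g p Y).

(* Integral of the 2-form omega over the part of W covered by the chart phi. *)
Definition chart_integral (phi : chart) (W : set H1) (omega : H1 -> H1 -> H1 -> R) : R :=
  (\int[(@lebesgue_measure R \x @lebesgue_measure R)%E]_(q in dom phi `&` phi @^-1` W)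
     omega (phi q) (du phi q) (dv phi q))%R.

Definition surface_measurable (W : set H1) : Prop :=
  forall phi, atl phi ->
    measurable (dom phi `&` phi @^-1` W : set (measurableTypeR R * measurableTypeR R)).

(* The filter "W -> {p}", W ranging over the measurable neighbourhoods of p
   in S: its members contain every W that lies in some fixed neighbourhood. *)
Definition shrinking_nbhds (S : set H1) (p : H1) : set_system (set H1) :=
  within [set W | W `<=` S /\ surface_measurable W]
    (powerset_filter_from (within S (nbhs p))).

(* K is the limit defining the Gaussian curvature at p. Since W eventually lies
   in the image of any chart around p, the integrals over W are computed in
   such a chart. *)
Definition is_gaussian_curvature (S : set H1) (eta : H1 -> H1)
    (conormal : H1 -> H1 -> R) (p : H1) (K : R) : Prop :=
  forall phi, atl phi -> (phi @` dom phi) p ->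
    chart_integral phi W (gauss_area_form conormal) /
    chart_integral phi W (area_form eta)
      @[W --> shrinking_nbhds S p] --> K.

End Surfaces.

Arguments chart R : clear implicits.

(* Main.v *)
Require Import Defs.
From HB Require Import structures.
From mathcomp Require Import all_boot all_order all_algebra.
From mathcomp Require Import all_classical all_reals all_analysis.
From mathcomp Require Import measurable_realfun ring lra.

Import Order.TTheory GRing.Theory Num.Theory.
Import numFieldNormedType.Exports.

Local Open Scope classical_set_scope.
Local Open Scope ring_scope.

(** Write eta = cos alpha e1 + sin alpha e2 and f1 = - sin alpha e1 + cos alpha e2.
    The conormal kills f1 and takes the value 1 on eta, so it is
    cos alpha e^1 + sin alpha e^2 - A e^0.  Everything is then a computation with
    the two functions alpha and A.

    Curvature.  Along the surface, the derivative of f1 in the frame (e0, e1, e2)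
    is - dalpha eta, which the projection along eta kills: f1 is parallel.  The
    derivative of f2 = e0 + A eta is dA eta + A dalpha f1, hence
    nabla_X f2 = A dalpha(X) f1 ([nabla_f2_phi]).  As f1 is parallel
    ([nabla_horizontal_phi]), R(f1, f2) f2 = d(A dalpha)(f1, f2) f1
    = (dA /\ dalpha)(f1, f2) f1 ([curvature_phi]); the second
    derivatives of alpha disappear because the commutator of f1 and f2, applied to
    alpha, is the derivative along their bracket ([derive_bracket]), which rests on
    the symmetry of second derivatives ([derive_comm]).

    Gauss map.  It is g = (cos alpha, sin alpha, - A), and a 3 x 3 determinant gives
    g^* (i(eta~) dV) = dA /\ dalpha ([gauss_area_phi]).  As dS(f1, f2) = 1, the
    pulled back area form is kappa dS with kappa = (dA /\ dalpha)(f1, f2), and the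
    quotient of the two areas tends to kappa(p) because kappa is continuous and the
    density of dS is continuous and positive ([ratio_integrals_near]).

    Two points need care.  The differential of a function on the surface is read
    in whichever chart represents the tangent vector, so its value in one chart has
    to be that in all others ([sdiff_chart]); this is shown by lifting lines
    from one chart to another.  And the conormal is only given pointwise: the
    smoothness of A, and of the components of f1 and f2 on the coordinate fields,
    comes from solving the linear equations they satisfy in a chart, whose
    determinant is the positive area density ([coefA_phi], [f1_dphi],
    [f2_dphi]). *)

Set Implicit Arguments.
Unset Strict Implicit.
Unset Printing Implicit Defensive.

(** * First-order expansions along curves *)

Lemma differentiable_dist_le (R : realType) (V W : normedModType R)
    (f : V -> W) (x : V) (e : R) : differentiable f x -> 0 < e ->
  \forall h \near (0 : V), `|f (h + x) - f x - 'd f x h| <= e * `|h|.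
Proof.
move=> /diff_locallyxP[_ df] e0.
have /eqaddoP /(_ _ e0) : (fun h => f (h + x)) =
    (fun h => f x + 'd f x h) +o_ (nbhs (0 : V)) id.
  by apply: eqaddoE; apply/funext => h; rewrite {1}df.
by apply: filterS => h /=; rewrite !fctE opprD addrA.
Qed.

Lemma row_mxnorm_ge (R : realType) n (y : 'rV[R]_n) i : `|y 0 i| <= `|y|.
Proof.
by rewrite [leRHS]/Num.Def.normr/= mx_normrE; exact: (le_bigmax _ _ (0, i)).
Qed.

(** The matrix of [f] has independent rows, hence a right inverse [B], and the
    norm of [B] bounds that of the inverse of [f] on its image. *)
Lemma injective_linear_bounded_below (R : realType) n
    (f : {linear (R * R)%type -> 'rV[R]_n}) :
  (forall z, f z = 0 -> z = 0) ->
  exists2 c, 0 < c & forall z, c * `|z| <= `|f z|.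
Proof.
move=> f_inj.
pose M : 'M[R]_(1 + 1, n) := col_mx (f (1, 0)) (f (0, 1)).
have fE a b : f (a, b) = row_mx a%:M b%:M *m M.
  rewrite mul_row_col !mul_scalar_mx -!linearZ/= -linearD/=; congr (f _).
  by apply/pair_equal_spec; split; rewrite /= ?scaler0 ?addr0 ?add0r ?[_ *: _]mulr1.
have /row_freeP[B MB] : row_free M.
  apply: inj_row_free => v.
  rewrite -[v]hsubmxK [lsubmx v]mx11_scalar [rsubmx v]mx11_scalar -fE.
  by move=> /f_inj[-> ->]; rewrite !raddf0 row_mx0.
have Bj z j : `|(f z *m B) 0 j| <= (\sum_i \sum_k `|B i k| + 1) * `|f z|.
  rewrite mxE (le_trans (ler_norm_sum _ _ _))// mulrDl mul1r.
  rewrite ler_wpDr// mulr_suml ler_sum// => i _.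
  rewrite normrM mulrC ler_pM//; last exact: row_mxnorm_ge.
  by rewrite (bigD1 j)//= lerDl sumr_ge0.
have C0 : 0 < \sum_i \sum_k `|B i k| + 1.
  by rewrite ltr_wpDl// sumr_ge0// => i _; rewrite sumr_ge0.
exists (\sum_i \sum_k `|B i k| + 1)^-1; first by rewrite invr_gt0.
move=> [a b]; rewrite ler_pdivrMl// prod_normE /= ge_max.
have := (Bj (a, b) (lshift 1 0), Bj (a, b) (rshift 1 0)).
rewrite fE -mulmxA MB mulmx1 row_mxEl row_mxEr !mxE eqxx !mulr1n.
by case=> -> ->.
Qed.

(** Through an immersion [phi], a curve [k] lying over a line of another
    parametrization has the expected velocity: the expansions of [phi] and [psi]
    give a bound for ['d phi q (k t - t *: w)], and ['d phi q] is bounded below.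
    As only continuity of [k] is assumed, this gives the differentiability of
    coordinate changes along lines. *)
Lemma lifted_line_tangent (R : realType) (V U W : normedModType R)
    (phi : V -> W) (psi : U -> W) (q w : V) (r z : U) (k : R -> V) (c : R) :
  differentiable phi q -> 0 < c -> (forall x, c * `|x| <= `|'d phi q x|) ->
  differentiable psi r -> 'd psi r z = 'd phi q w ->
  k t @[t --> (0 : R)] --> (0 : V) ->
  (\forall t \near (0 : R), psi (t *: z + r) = phi (k t + q)) ->
  psi r = phi q ->
  forall e, 0 < e -> \forall t \near (0 : R), `|k t - t *: w| <= e * `|t|.
Proof.
move=> dphi c0 hc dpsi eqd k0 eqk eq0 e e0.
pose s := `|z| + `|w|.
have s0 : 0 <= s by rewrite addr_ge0.
have es0 : 0 < 2 * e + s by rewrite ltr_wpDr// mulr_gt0.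
(* With this precision in both expansions, the errors add up to
   [d * (s * |t| + |k t - t *: w|)], and [d * s <= (c - d) * e]. *)
pose d := c * e / (2 * e + s).
have d0 : 0 < d by rewrite divr_gt0// mulr_gt0.
have dE : d * (2 * e + s) = c * e by rewrite divfK// gt_eqF.
have tz0 : (fun t : R => t *: z) @ (0 : R) --> (0 : U).
  rewrite -[X in _ --> X](scale0r z); exact: scalel_continuous.
have P1 := differentiable_dist_le dphi d0.
have P2 := differentiable_dist_le dpsi d0.
move: (k0 _ P1) (tz0 _ P2); rewrite !near_simpl => Q1 Q2; near=> t.
have X : `|phi (k t + q) - phi q - 'd phi q (k t)| <= d * `|k t|.
  by near: t; exact: Q1.
have Y : `|psi (t *: z + r) - psi r - 'd psi r (t *: z)| <= d * `|t *: z|.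
  by near: t; exact: Q2.
have E : psi (t *: z + r) = phi (k t + q) by near: t; exact: eqk.
have := hc (k t - t *: w).
have dt : 'd phi q (t *: w) = 'd psi r (t *: z).
  by rewrite (linearZZ ('d phi q)) (linearZZ ('d psi r)) eqd.
rewrite (linearB ('d phi q)) dt => L.
have L1 : `|'d phi q (k t) - 'd psi r (t *: z)| <= d * `|k t| + d * `|t *: z|.
  rewrite (_ : _ - _ =
     (psi (t *: z + r) - psi r - 'd psi r (t *: z)) -
     (phi (k t + q) - phi q - 'd phi q (k t))).
    by rewrite (le_trans (ler_normB _ _))// addrC lerD.
  by rewrite E eq0; set X0 := _ - phi q; rewrite opprB [RHS]addrC subrKA.
have L2 : `|k t| <= `|k t - t *: w| + `|t| * `|w|.
  by rewrite -normrZ -{1}(subrK (t *: w) (k t)) ler_normD.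
rewrite normrZ in L1.
have t0 : 0 <= `|t| by [].
move: L L1 L2; rewrite /s in dE es0 s0.
move: (`|k t - t *: w|) (`|k t|) (`|t|) t0 => x y t' t'0 L L1 L2.
have dc : d < c.
  rewrite -(ltr_pM2r es0) dE mulrDr ltr_wpDr ?mulr_ge0 ?(ltW c0)//.
  by rewrite ltr_pM2l// ltr_pMl// ltr1n.
rewrite -(@ler_pM2l _ (c - d)) ?subr_gt0//.
have := le_trans L L1.
have : d * y <= d * (x + t' * `|w|) by rewrite ler_pM2l.
have : 0 <= d * (e * t').
  by rewrite mulr_ge0 ?(ltW d0)// mulr_ge0// ltW.
have : d * (2 * e + (`|z| + `|w|)) * t' = c * e * t' by rewrite dE.
lra.
Unshelve. all: by end_near. Qed.

(** To first order the curve [k] is the line through [q] of direction [w], and the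
    error made on [F] by replacing one by the other is of higher order, ['d F q]
    being Lipschitz. *)
Lemma is_derive_along_curve (R : realType) (V W U : normedModType R)
    (F : V -> W) (h : U -> W) (q w : V) (r z : U) (k : R -> V) :
  differentiable F q -> k t @[t --> (0 : R)] --> (0 : V) ->
  (forall e, 0 < e -> \forall t \near (0 : R), `|k t - t *: w| <= e * `|t|) ->
  (\forall t \near (0 : R), h (t *: z + r) = F (k t + q)) -> h r = F q ->
  is_derive r z h ('d F q w).
Proof.
move=> dF k0 kw eqh eq0.
have [C C0 FC] := linear_lipschitz (diff_continuous dF).
suff H : t^-1 *: (h (t *: z + r) - h r) @[t --> 0^'] --> 'd F q w.
  by apply: DeriveDef; [apply/cvg_ex; eexists; exact: H | exact/cvg_lim].
apply/cvgrPdist_le => e e0.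
pose e1 := e / (2 * (`|w| + 1)).
pose e2 := Num.min 1 (e / (2 * C)).
have w1 : 0 < `|w| + 1 by rewrite ltr_wpDl.
have e1_0 : 0 < e1 by rewrite divr_gt0// mulr_gt0.
have e2_0 : 0 < e2 by rewrite lt_min ltr01 divr_gt0// mulr_gt0.
have P1 := differentiable_dist_le dF e1_0.
move: (k0 _ P1); rewrite !near_simpl => Q1.
have Q2 := kw _ e2_0.
near=> t.
have t0 : t != 0 by near: t; exact: nbhs_dnbhs_neq.
have X : `|F (k t + q) - F q - 'd F q (k t)| <= e1 * `|k t|.
  by near: t; exact: cvg_within Q1.
have Y : `|k t - t *: w| <= e2 * `|t| by near: t; exact: cvg_within Q2.
have -> : h (t *: z + r) = F (k t + q) by near: t; exact: cvg_within eqh.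
rewrite eq0 -(@ler_pM2l _ `|t|) ?normr_gt0// -normrZ scalerBr scalerA.
rewrite divff// scale1r -linearZ/= distrC.
rewrite -(subrK ('d F q (k t)) (F _ - _)) -addrA -linearB.
rewrite (le_trans (ler_normD _ _))//.
have Z : `|k t| <= (`|w| + 1) * `|t|.
  rewrite -{1}(subrK (t *: w) (k t)) (le_trans (ler_normD _ _))//.
  rewrite normrZ mulrDl mul1r addrC [_ * `|t|]mulrC lerD2l (le_trans Y)//.
  by rewrite ler_piMl// ge_min lexx.
rewrite (le_trans (lerD X (FC _)))//.
have -> : `|t| * e = e1 * ((`|w| + 1) * `|t|) + C * (e / (2 * C) * `|t|).
  by rewrite /e1; field; rewrite !gt_eqF.
rewrite lerD// ler_pM2l// (le_trans Y)// ler_wpM2r//.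
by rewrite ge_min lexx orbT.
Unshelve. all: by end_near. Qed.

(** * The differential of a function on a surface *)

Section ChartIndependence.
Context (R : realType) (S : set 'rV[R]_3) (atl : set (chart R)).
Hypothesis hS : oriented_surface S atl.

Lemma chart_open phi : atl phi -> open (dom phi).
Proof. by move=> /(atlas_par hS)/par_dom. Qed.

Lemma chart_mem phi q : atl phi -> dom phi q -> S (phi q).
Proof.
move=> aphi dq; have P := atlas_par hS aphi.
have [V _ E] := par_open P (par_dom P) (@subset_refl _ _).
by have : (phi @` dom phi) (phi q) by [exists q]; rewrite E => -[].
Qed.

Lemma chart_differentiable phi q : atl phi -> dom phi q -> differentiable phi q.
Proof. by move=> /(atlas_par hS)/par_smooth/(_ 1%N)[+ _] => /[apply]. Qed.

(** A chart is a homeomorphism onto a relatively open part of the surface, so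
    continuous maps into the surface factor continuously through it. *)
Lemma chart_lift phi q (T : topologicalType) (f : T -> 'rV[R]_3) (t : T) :
  atl phi -> dom phi q -> f t = phi q -> {for t, continuous f} ->
  (\forall s \near t, S (f s)) ->
  exists2 k : T -> R * R, k s @[s --> t] --> (0 : R * R) &
    \forall s \near t, f s = phi (k s + q).
Proof.
move=> aphi dq ft cf fS; have P := atlas_par hS aphi.
pose g s := get [set x | dom phi x /\ phi x = f s].
have near_lift (B : set (R * R)) : nbhs q B ->
    \forall s \near t, B (g s) /\ phi (g s) = f s.
  rewrite nbhsE => -[V0 [oO Oq] OB].
  have oOd : open (dom phi `&` V0) by apply: openI => //; exact: chart_open.
  have [V oV E] := par_open P oOd (@subIsetl _ _ _).
  have : \forall s \near t, V (f s).
    apply: cf; apply: open_nbhs_nbhs; split=> //; rewrite ft.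
    by have : (phi @` (dom phi `&` V0)) (phi q) by [exists q]; rewrite E => -[].
  apply: filterS2 fS => s Ss Vs.
  have [x [dx Ox] xE] : (phi @` (dom phi `&` V0)) (f s) by rewrite E.
  have [dg gE] : [set x' | dom phi x' /\ phi x' = f s] (g s).
    by apply: getPex; exists x.
  rewrite (_ : g s = x); last by apply: (par_inj P); rewrite ?inE// gE xE.
  by split=> //; exact: OB.
exists (fun s => g s - q).
  have -> : 0 = q - q by rewrite subrr.
  apply: cvgB; last exact: cvg_cst.
  by move=> B /near_lift; rewrite /= near_simpl; apply: filterS => s [].
by apply: filterS (near_lift _ (@filterT _ (nbhs q) _)) => s [_ /esym]; rewrite subrK.
Qed.

(** The value computed in another chart [psi] is the derivative of [h \o psi]
    along a line, which is the derivative of [h \o phi] along the lift of that line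
    to the domain of [phi].  Differentiability in the single chart [phi] is enough:
    it forces the derivative in [psi] to exist. *)
Lemma sdiff_chart (W : normedModType R) (h : 'rV[R]_3 -> W) phi q w :
  atl phi -> dom phi q -> differentiable (h \o phi) q ->
  sdiff atl h (phi q) ('D_w phi q) = 'D_w (h \o phi) q.
Proof.
move=> aphi dq dh; apply: get_unique.
  by exists phi, q, w.
move=> _ [psi [r [z [apsi dr rq eqD <-]]]].
have dpsi := chart_differentiable apsi dr.
have dphi := chart_differentiable aphi dq.
have line0 : (fun t : R => t *: z + r) @ (0 : R) --> r.
  rewrite -[X in _ --> X]add0r -(scale0r z).
  by apply: cvgD; [exact: scalel_continuous | exact: cvg_cst].
have line_dom : \forall t \near (0 : R), dom psi (t *: z + r).
  apply: line0; apply: open_nbhs_nbhs; split => //; exact: chart_open.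
have [k k0 kE] : exists2 k : R -> R * R, k t @[t --> (0 : R)] --> (0 : R * R) &
    \forall t \near (0 : R), psi (t *: z + r) = phi (k t + q).
  have E0 : (0 : R) *: z + r = r by rewrite scale0r add0r.
  apply: chart_lift => //=; first by rewrite E0.
    apply: (@continuous_comp _ _ _ (fun t : R => t *: z + r) psi).
      by rewrite /prop_for /continuous_at E0.
    by rewrite E0; exact: differentiable_continuous.
  by apply: filterS line_dom => t; exact: chart_mem.
have [c c0 hc] : exists2 c, 0 < c & forall x, c * `|x| <= `|'d phi q x|.
  apply: injective_linear_bounded_below => x; rewrite -deriveE//.
  exact: par_immersion (atlas_par hS aphi) _ dq x.
have eqd : 'd psi r z = 'd phi q w.
  have d1 := deriveE z dpsi; have d2 := deriveE w dphi.
  exact: etrans (esym d1) (etrans eqD d2).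
have kw := lifted_line_tangent dphi c0 hc dpsi eqd k0 kE rq.
have D : is_derive r z (h \o psi) ('d (h \o phi) q w).
  apply: (is_derive_along_curve dh k0 kw); last by rewrite /= rq.
  by apply: filterS kE => t /= ->.
by rewrite (@derive_val _ _ _ _ _ _ _ D) -deriveE.
Qed.

End ChartIndependence.

(** * Smooth functions on an open set *)

Lemma near_eq_differentiable (R : realType) (V W : normedModType R)
    (f g : V -> W) (x : V) :
  (\forall y \near x, f y = g y) -> differentiable f x -> differentiable g x.
Proof.
move=> fg /diffP[cf ef].
apply/diffP; apply: (@getPex _ (fun df : {linear V -> W} => continuous df /\
  forall y, g y = g (lim (nbhs x)) + df (y - lim (nbhs x))
                  +o_(y \near x) (y - lim (nbhs x)))).
exists ('d f x); split=> //.
have lx : lim (nbhs x) = x by exact: lim_id.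
have fgx : f x = g x := nbhs_singleton fg.
suff : g = (fun y => g (lim (nbhs x)) + 'd f x (y - lim (nbhs x)))
    +o_ (nbhs x) (fun y => y - lim (nbhs x)) by rewrite funeqE.
apply/eqaddoP => e e0.
have /eqaddoP/(_ _ e0) : f = (fun y => f (lim (nbhs x)) + 'd f x (y - lim (nbhs x)))
   +o_ (nbhs x) (fun y => y - lim (nbhs x)).
  by apply: eqaddoE; apply/funext => y; rewrite {1}ef.
by apply: filterS2 fg => y; rewrite !lx /= !fctE -fgx => ->.
Qed.

Section SmoothAlgebra.
Context (R : realType) (V : normedModType R) (O : set V).
Hypothesis oO : open O.

Lemma eq_on_near (T : Type) (f g : V -> T) x : (forall x, O x -> f x = g x) ->
  O x -> \forall y \near x, f y = g y.
Proof. by move=> fg Ox; apply: filterS fg _; apply: open_nbhs_nbhs. Qed.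

Lemma Ck_ext (W : normedModType R) n (f g : V -> W) :
  (forall x, O x -> f x = g x) -> Ck n O f -> Ck n O g.
Proof.
elim: n f g => [|n IH] f g fg /=.
  move=> cf x Ox; have := cf x Ox; rewrite /prop_for /continuous_at (fg x Ox).
  by apply: cvg_trans; apply: near_eq_cvg; exact: eq_on_near.
move=> [df Df]; split=> [x Ox|v].
  by apply: near_eq_differentiable (df x Ox); exact: eq_on_near.
by apply: IH (Df v) => x Ox; apply: near_eq_derive; exact: eq_on_near.
Qed.

Lemma CkS (W : normedModType R) n (f : V -> W) : Ck n.+1 O f -> Ck n O f.
Proof.
elim: n f => [|n IH] f [df Df].
  by move=> x /df/differentiable_continuous.
by split=> // v; apply: IH.
Qed.

Lemma smooth_ext (W : normedModType R) (f g : V -> W) :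
  (forall x, O x -> f x = g x) -> smooth_on O f -> smooth_on O g.
Proof. by move=> fg sf n; exact: Ck_ext (sf n). Qed.

Lemma smooth_differentiable (W : normedModType R) (f : V -> W) x :
  smooth_on O f -> O x -> differentiable f x.
Proof. by move=> /(_ 1%N)[+ _] => /[apply]. Qed.

Lemma smooth_derivable (W : normedModType R) (f : V -> W) x v :
  smooth_on O f -> O x -> derivable f x v.
Proof. by move=> sf Ox; apply: diff_derivable; exact: smooth_differentiable sf Ox. Qed.

Lemma smooth_continuous (W : normedModType R) (f : V -> W) x :
  smooth_on O f -> O x -> {for x, continuous f}.
Proof. by move=> /(_ 0%N) + Ox; exact. Qed.

Lemma smooth_derive (W : normedModType R) (f : V -> W) v :
  smooth_on O f -> smooth_on O ('D_v f).
Proof. by move=> sf n; have [_] := sf n.+1; exact. Qed.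

Lemma smooth_cst (W : normedModType R) (c : W) : smooth_on O (fun=> c).
Proof.
move=> n; elim: n c => [|n IH] c; first by move=> x _; exact: cvg_cst.
split=> [x _|v]; first exact: differentiable_cst.
by apply: Ck_ext (IH 0) => x _; exact: (esym (derive_cst c x v)).
Qed.

Implicit Types f g : V -> R.

Lemma CkD n f g : Ck n O f -> Ck n O g -> Ck n O (fun x => f x + g x).
Proof.
elim: n f g => [|n IH] f g.
  by move=> cf cg x Ox; apply: cvgD; [exact: cf | exact: cg].
move=> [df Df] [dg Dg]; split=> [x Ox|v].
  by apply: differentiableD; [exact: df | exact: dg].
apply: Ck_ext (IH _ _ (Df v) (Dg v)) => x Ox; rewrite -deriveD//.
- exact/diff_derivable/df.
- exact/diff_derivable/dg.
Qed.

Lemma CkM n f g : Ck n O f -> Ck n O g -> Ck n O (fun x => f x * g x).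
Proof.
elim: n f g => [|n IH] f g.
  by move=> cf cg x Ox; apply: cvgM; [exact: cf | exact: cg].
move=> cf cg; case: (cf) (cg) => [df Df] [dg Dg]; split=> [x Ox|v].
  by apply: differentiableM; [exact: df | exact: dg].
apply: Ck_ext (CkD (IH _ _ (CkS cf) (Dg v)) (IH _ _ (CkS cg) (Df v))) => x Ox.
rewrite [RHS](@deriveM _ _ f g x v)//.
- exact/diff_derivable/df.
- exact/diff_derivable/dg.
Qed.

Lemma CkV n f : (forall x, O x -> f x != 0) -> Ck n O f ->
  Ck n O (fun x => (f x)^-1).
Proof.
move=> f0; elim: n => [|n IH].
  by move=> cf x Ox; apply: cvgV; [exact: f0 | exact: cf].
move=> cf; case: (cf) => [df Df]; split=> [x Ox|v].
  by apply: differentiableV; [exact: df | exact: f0].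
have cV := IH (CkS cf).
have cN : Ck n O (fun=> -1 : R) by exact: smooth_cst.
apply: Ck_ext (CkM cN (CkM (CkM cV cV) (Df v))) => x Ox.
rewrite [RHS](@deriveV _ _ f x v) ?f0//; last exact/diff_derivable/df.
by rewrite mulN1r scaleNr expr2 invfM.
Qed.

Lemma smoothD f g : smooth_on O f -> smooth_on O g ->
  smooth_on O (fun x => f x + g x).
Proof. by move=> sf sg n; exact: CkD. Qed.

Lemma smoothM f g : smooth_on O f -> smooth_on O g ->
  smooth_on O (fun x => f x * g x).
Proof. by move=> sf sg n; exact: CkM. Qed.

Lemma smoothV f : (forall x, O x -> f x != 0) -> smooth_on O f ->
  smooth_on O (fun x => (f x)^-1).
Proof. by move=> f0 sf n; exact: CkV. Qed.

Lemma smoothN f : smooth_on O f -> smooth_on O (fun x => - f x).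
Proof.
move=> sf; have cN : smooth_on O (fun=> -1 : R) by exact: smooth_cst.
by apply: (smooth_ext _ (smoothM cN sf)) => x _; rewrite mulN1r.
Qed.

Lemma smoothB f g : smooth_on O f -> smooth_on O g ->
  smooth_on O (fun x => f x - g x).
Proof. by move=> sf sg; apply: smoothD => //; exact: smoothN. Qed.

Lemma differentiable_derive_comp (h : R -> R) (h' : R) f x v :
  is_derive (f x) 1 h h' -> differentiable f x ->
  differentiable (h \o f) x /\ 'D_v (h \o f) x = h' * 'D_v f x.
Proof.
move=> [dh <-] df.
have Dh : differentiable h (f x) by apply/derivable1_diffP.
have dhf : differentiable (h \o f) x by exact: differentiable_comp.
split=> //; rewrite (deriveE v dhf) (diff_comp df Dh) /= -(deriveE v df).
by rewrite (deriv1E dh) derive1E mulrC.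
Qed.

Lemma Ck_cos_sin n f : Ck n O f ->
  Ck n O (fun x => cos (f x)) /\ Ck n O (fun x => sin (f x)).
Proof.
elim: n => [|n IH].
  move=> cf; split=> x Ox; apply: (@continuous_comp _ _ _ f) (cf x Ox) _.
    exact: continuous_cos.
  exact: continuous_sin.
move=> cf; have [cc cs] := IH (CkS cf); case: cf => [df Df].
have cN : Ck n O (fun=> -1 : R) by exact: smooth_cst.
have Dc x v Ox := differentiable_derive_comp v (is_derive_cos (f x)) (df x Ox).
have Ds x v Ox := differentiable_derive_comp v (is_derive_sin (f x)) (df x Ox).
split; split=> [x Ox|v].
- by have [] := Dc x 0 Ox.
- apply: Ck_ext (CkM (CkM cN cs) (Df v)) => x Ox.
  by have [_ ->] := Dc x v Ox; rewrite mulN1r.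
- by have [] := Ds x 0 Ox.
- apply: Ck_ext (CkM cc (Df v)) => x Ox.
  by have [_ ->] := Ds x v Ox.
Qed.

Lemma smooth_cos f : smooth_on O f -> smooth_on O (fun x => cos (f x)).
Proof. by move=> sf n; have [] := Ck_cos_sin (sf n). Qed.

Lemma smooth_sin f : smooth_on O f -> smooth_on O (fun x => sin (f x)).
Proof. by move=> sf n; have [] := Ck_cos_sin (sf n). Qed.

Lemma differentiable_entry m k (f : V -> 'M[R]_(m, k)) i j x :
  differentiable f x -> differentiable (fun y => f y i j) x.
Proof.
move=> df; apply: (@differentiable_comp _ _ _ _ f (fun M => M i j)) => //.
exact: differentiable_coord.
Qed.

Lemma smooth_entry m k (f : V -> 'M[R]_(m, k)) i j : smooth_on O f ->
  smooth_on O (fun x => f x i j).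
Proof.
move=> + n; elim: n f => [|n IH] f sf.
  move=> x Ox; apply: differentiable_continuous; apply: differentiable_entry.
  exact: smooth_differentiable sf Ox.
split=> [x Ox|v].
  by apply: differentiable_entry; exact: smooth_differentiable sf Ox.
apply: Ck_ext (IH _ (smooth_derive v sf)) => x Ox.
by rewrite derive_mx ?mxE//; exact: smooth_derivable sf Ox.
Qed.

(** Matrix-valued maps are assembled from their entries through the canonical
    basis, since sums and multiples of constant vectors are differentiable. *)
Lemma differentiable_row n (f : 'I_n -> V -> R) x :
  (forall i, differentiable (f i) x) -> differentiable (fun y => \row_i f i y) x.
Proof.
move=> df.
have -> : (fun y => \row_i f i y) = \sum_i (fun y => f i y *: 'e_i).
  by apply/funext => y; rewrite fct_sumE [LHS]row_sum_delta; under eq_bigr do rewrite mxE.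
by apply: differentiable_sum => i; apply: differentiableZl.
Qed.

Lemma derive_row n (f : 'I_n -> V -> R) x v :
  (forall i, differentiable (f i) x) ->
  'D_v (fun y => \row_i f i y) x = \row_i 'D_v (f i) x.
Proof.
move=> df; rewrite derive_mx; last exact/diff_derivable/differentiable_row.
apply/rowP => i; rewrite !mxE; congr ('D_v _ x).
by apply/funext => y; rewrite mxE.
Qed.

Lemma smooth_row n (f : 'I_n -> V -> R) : (forall i, smooth_on O (f i)) ->
  smooth_on O (fun y => \row_i f i y).
Proof.
move=> + m; elim: m f => [|m IH] f sf.
  move=> x Ox; apply: differentiable_continuous; apply: differentiable_row => i.
  exact: smooth_differentiable (sf i) Ox.
split=> [x Ox|v].
  by apply: differentiable_row => i; exact: smooth_differentiable (sf i) Ox.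
apply: Ck_ext (IH _ (fun i => smooth_derive v (sf i))) => x Ox.
by rewrite derive_row// => i; exact: smooth_differentiable (sf i) Ox.
Qed.

End SmoothAlgebra.

(** * Integrals over small neighbourhoods in the plane *)

Section PlaneMeasure.
Context (R : realType).
Local Notation plane := (measurableTypeR R * measurableTypeR R)%type.
Local Notation mu := (@lebesgue_measure R \x @lebesgue_measure R)%E.

Lemma rat_near_ball (x r : R) : 0 < r -> exists a : rat, ball (ratr a : R) r x.
Proof.
move=> r0; have : x - r < x + r by rewrite ltrD2l gtrN.
move=> /rat_in_itvoo[a]; rewrite in_itv /= => /andP[a1 a2]; exists a.
by rewrite -ball_normE /ball_ /= ltr_norml ltrBrDl a1 /= ltrBlDr addrC.
Qed.

(** The product sigma-algebra is generated by rectangles, and an open set is the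
    countable union of the squares that it contains, with rational centre and
    half side [1 / (n + 1)]. *)
Lemma measurable_open_plane (O : set (R * R)) : open O -> measurable (O : set plane).
Proof.
move=> oO.
pose box (i : rat * rat * nat) : set (R * R) :=
  ball (ratr i.1.1 : R) i.2.+1%:R^-1 `*` ball (ratr i.1.2 : R) i.2.+1%:R^-1.
have -> : O = \bigcup_i (if `[< box i `<=` O >] then box i else set0).
  apply/seteqP; split=> [q Oq|q [i _]]; last by case: asboolP => // iO /iO.
  have /nbhs_ballP[e /= e0 qe] : nbhs q O by apply: open_nbhs_nbhs.
  have [n ne] : exists n : nat, n.+1%:R^-1 < e / 2.
    have := near_infty_natSinv_lt (PosNum (divr_gt0 e0 (ltr0Sn R 1))).
    by case=> n _ /(_ n (leqnn n)) /= H; exists n.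
  have n0 : 0 < n.+1%:R^-1 :> R by rewrite invr_gt0.
  have [a aq] := rat_near_ball q.1 n0.
  have [b bq] := rat_near_ball q.2 n0.
  have boxO : box (a, b, n) `<=` O.
    have e2 : n.+1%:R^-1 + n.+1%:R^-1 <= e by rewrite [leRHS]splitr lerD// ltW.
    move=> [x y] [ax bx]; apply: qe; split.
      exact: le_ball e2 _ (ball_triangle (ball_sym aq) ax).
    exact: le_ball e2 _ (ball_triangle (ball_sym bq) bx).
  by exists (a, b, n) => //; rewrite asboolT.
apply: countable_bigcupT_measurable => [|i]; first exact: countableP.
case: asboolP => // _.
by apply: measurableX; apply: open_measurable; exact: ball_open.
Qed.

Lemma measurable_fun_open_plane (O W : set (R * R)) (f : R * R -> R) :
  open O -> W `<=` O -> (forall x, O x -> {for x, continuous f}) ->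
  measurable (W : set plane) -> measurable_fun (W : set plane) f.
Proof.
move=> oO WO cf mW.
apply: (measurability _ (RGenOpens.measurableE R)) => _ [_ [a [b ->] <-]].
have -> : W `&` f @^-1` `]a, b[ = W `&` (O `&` f @^-1` `]a, b[).
  by rewrite setIA (setIidl WO).
apply: measurableI => //; apply: measurable_open_plane.
rewrite openE => x [Ox fx]; apply: filterI; first exact: open_nbhs_nbhs.
apply: (cf x Ox); apply: open_nbhs_nbhs; split=> //; exact: interval_open.
Qed.

Lemma lebesgue2_ball (q : R * R) (r : R) : 0 < r ->
  mu (ball q r) = (r *+ 2 * (r *+ 2))%:E.
Proof.
move=> r0.
have -> : ball q r = ball q.1 r `*` ball q.2 r by [].
rewrite product_measure1E; try by apply: open_measurable; exact: ball_open.
exact: (congr2 mule (lebesgue_measure_ball q.1 (ltW r0))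
  (lebesgue_measure_ball q.2 (ltW r0))).
Qed.

(** Near [q], [k] is within [e] of [k q], so the integral of [k * N] lies between
    [k q - e] and [k q + e] times the integral of the positive function [N].  The
    bounds on [N] make both integrands integrable and the denominator positive. *)
Lemma ratio_integrals_near (O : set (R * R)) (k N : R * R -> R) (q : R * R) (e : R) :
  open O -> O q -> (forall x, O x -> {for x, continuous k}) ->
  (forall x, O x -> {for x, continuous N}) -> (forall x, O x -> 0 < N x) -> 0 < e ->
  exists V, [/\ open V, V q, V `<=` O & forall W : set (R * R),
    measurable (W : set plane) -> nbhs q W -> W `<=` V ->
    `|k q - (\int[mu]_(x in W) (k x * N x))%R / (\int[mu]_(x in W) N x)%R| <= e].
Proof.
move=> oO Oq ck cN N0 e0.
have Nq := N0 q Oq.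
have Nq2 : 0 < N q / 2 by rewrite divr_gt0.
have B : nbhs q [set x | [/\ O x, `|k q - k x| <= e & `|N q - N x| <= N q / 2]].
  have B1 : nbhs q O by apply: open_nbhs_nbhs.
  have B2 : nbhs q [set x | `|k q - k x| <= e].
    by move/cvgrPdist_le : (ck q Oq) => /(_ _ e0).
  have B3 : nbhs q [set x | `|N q - N x| <= N q / 2].
    by move/cvgrPdist_le : (cN q Oq) => /(_ _ Nq2).
  by apply: filterS (filterI B1 (filterI B2 B3)) => x [x1 [x2 x3]]; exact: And3 x1 x2 x3.
move/nbhs_ballP : B => [r /= r0 rB].
exists (ball q r); split; [exact: ball_open | exact: ballxx | by move=> x /rB[] | ].
move=> W mW qW Wr.
have WO : W `<=` O by move=> x /Wr/rB[].
have mN := measurable_fun_open_plane oO WO cN mW.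
have mk := measurable_fun_open_plane oO WO ck mW.
have muW : (mu W < +oo)%E.
  rewrite (@le_lt_trans _ _ (mu (ball q r)))//.
    by apply: le_measure; rewrite ?inE//; apply: measurable_open_plane; exact: ball_open.
  by rewrite lebesgue2_ball// ltry.
have bounded_integrable (f : R * R -> R) M : measurable_fun (W : set plane) f ->
    (forall x, W x -> `|f x| <= M) -> mu.-integrable (W : set plane) (EFin \o f).
  move=> mf fM; apply: measurable_bounded_integrable => //.
  exists M; split; first exact: num_real.
  by move=> M' MM' x Wx /=; rewrite (le_trans (fM _ Wx))// ltW.
have W_bounds x : W x -> [/\ N q / 2 <= N x, `|N x| <= 2 * N q &
    k q - e <= k x <= k q + e].
  move=> Wx; have [Ox] := rB _ (Wr _ Wx); rewrite !ler_norml.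
  move=> /andP[k1 k2] /andP[n1 n2]; split; first lra.
    by apply/andP; split; lra.
  by apply/andP; split; lra.
have iN : mu.-integrable (W : set plane) (EFin \o N).
  by apply: (bounded_integrable _ (2 * N q)) => [|x /W_bounds[]].
have ikN : mu.-integrable (W : set plane) (EFin \o (fun x => k x * N x)).
  apply: (bounded_integrable _ ((`|k q| + e) * (2 * N q))) => [|x Wx].
    exact: (measurable_funM mk mN).
  have [_ n1 /andP[k1 k2]] := W_bounds _ Wx.
  rewrite normrM ler_pM// -lerBlDl (le_trans (lerB_dist _ _))//.
  by rewrite ler_norml; apply/andP; split; lra.
have iC (r' : R) : mu.-integrable (W : set plane) (EFin \o (fun=> r')).
  by apply: (bounded_integrable _ `|r'|).
have iZ (r' : R) : mu.-integrable (W : set plane) (EFin \o (fun x => r' * N x)).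
  apply: (bounded_integrable _ (`|r'| * (2 * N q))) => [|x /W_bounds[_ n1 _]].
    exact: (measurable_funM (@measurable_cst _ _ _ _ _ r') mN).
  by rewrite normrM ler_wpM2l.
have muW0 : 0 < fine (mu W).
  rewrite fine_gt0// muW andbT.
  move/nbhs_ballP : qW => [d /= d0 dW].
  rewrite (@lt_le_trans _ _ (mu (ball q d)))//.
    by rewrite lebesgue2_ball// lte_fin mulr_gt0// pmulrn_lgt0.
  by apply: le_measure; rewrite ?inE//; apply: measurable_open_plane; exact: ball_open.
have IN0 : 0 < \int[mu]_(x in W) N x.
  rewrite (@lt_le_trans _ _ (\int[mu]_(x in W) (N q / 2)))//.
    by rewrite Rintegral_cst// mulr_gt0.
  by apply: le_Rintegral => // x /W_bounds[].
have H1 : (k q - e) * \int[mu]_(x in W) N x <= \int[mu]_(x in W) (k x * N x).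
  rewrite -RintegralZl//; apply: le_Rintegral => // x Wx.
  have [_ _ /andP[k1 _]] := W_bounds _ Wx.
  by rewrite ler_wpM2r// ltW// N0//; exact: WO.
have H2 : \int[mu]_(x in W) (k x * N x) <= (k q + e) * \int[mu]_(x in W) N x.
  rewrite -RintegralZl//; apply: le_Rintegral => // x Wx.
  have [_ _ /andP[_ k1]] := W_bounds _ Wx.
  by rewrite ler_wpM2r// ltW// N0//; exact: WO.
rewrite distrC ler_distl ler_pdivlMr// ler_pdivrMr// H1; exact: H2.
Qed.
End PlaneMeasure.

(** * Second derivatives and brackets of plane vector fields *)

Lemma is_derive_line (R : realType) (V W : normedModType R) (f : V -> W)
    (p v : V) (s : R) : derivable f (p + s *: v) v ->
  is_derive s 1 (fun t : R => f (p + t *: v)) ('D_v f (p + s *: v)).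
Proof.
move=> df.
have E : (fun h : R => h^-1 *: (((fun t : R => f (p + t *: v)) \o shift s) (h *: 1)
    - f (p + s *: v))) =
    (fun h : R => h^-1 *: ((f \o shift (p + s *: v)) (h *: v) - f (p + s *: v))).
  apply/funext => h /=; congr (_ *: (f _ - _)).
  by rewrite [h *: 1]mulr1 scalerDl addrCA.
by apply: DeriveDef; [rewrite /derivable E | rewrite /derive E].
Qed.

(** The mean value theorem is applied to the increment of [F] in the direction
    [w], as a function of the parameter along [v], and then to ['D_v F] in the
    direction [w]. *)
Lemma second_difference_mvt (R : realType) (V : normedModType R) (F : V -> R)
    (p v w : V) (h : R) : 0 <= h ->
  (forall s t, 0 <= s <= h -> 0 <= t <= h ->
     differentiable F (p + s *: v + t *: w) /\
     differentiable ('D_v F) (p + s *: v + t *: w)) ->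
  exists s t, [/\ 0 <= s <= h, 0 <= t <= h &
    F (p + h *: v + h *: w) - F (p + h *: v) - F (p + h *: w) + F p =
    h * h * 'D_w ('D_v F) (p + s *: v + t *: w)].
Proof.
move=> h0 dF.
have hh : 0 <= h <= h by rewrite h0 lexx.
have h00 : 0 <= (0 : R) <= h by rewrite h0 lexx.
pose phi s := F (p + h *: w + s *: v) - F (p + s *: v).
pose dphi s := 'D_v F (p + h *: w + s *: v) - 'D_v F (p + s *: v).
have dphiP s : 0 <= s <= h -> is_derive s 1 phi (dphi s).
  move=> sh.
  apply: is_deriveB; apply: is_derive_line; apply: diff_derivable.
    by rewrite addrAC; have [] := dF s h sh hh.
  by have [] := dF s 0 sh h00; rewrite scale0r addr0.
have incl s : s \in `]0, h[%R -> 0 <= s <= h.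
  by rewrite in_itv /= => /andP[/ltW -> /ltW ->].
have within_cont (f df : R -> R) : (forall s, 0 <= s <= h -> is_derive s 1 f (df s)) ->
    {within `[0, h], continuous f}.
  move=> D; apply: derivable_within_continuous => s.
  by rewrite in_itv /= => /D[].
have [s] := MVT_segment h0 (fun s sh => dphiP s (incl s sh)) (within_cont _ _ dphiP).
rewrite in_itv /= => sh phiE.
pose psi t := 'D_v F (p + s *: v + t *: w).
have psiP t : 0 <= t <= h -> is_derive t 1 psi ('D_w ('D_v F) (p + s *: v + t *: w)).
  by move=> th; apply: is_derive_line; apply: diff_derivable; have [] := dF s t sh th.
have [t] := MVT_segment h0 (fun s sh => psiP s (incl s sh)) (within_cont _ _ psiP).
rewrite in_itv /= => th psiE.
exists s, t; split=> //.
rewrite subr0 in phiE psiE.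
have dphiE : dphi s = 'D_w ('D_v F) (p + s *: v + t *: w) * h.
  by rewrite -psiE /psi scale0r addr0 addrAC.
transitivity (dphi s * h); last by rewrite dphiE -mulrA mulrC.
rewrite -phiE /phi !scale0r !addr0 [p + h *: v + _]addrAC; ring.
Qed.

(** Symmetry of second derivatives: the second difference on a small
    parallelogram does not depend on the order of [v] and [w], so that both mixed
    derivatives take a common value, up to the choice of the points, arbitrarily
    close to [q]. *)
Lemma derive_comm (R : realType) (V : normedModType R) (O : set V) (F : V -> R)
    (q v w : V) : open O -> O q -> smooth_on O F ->
  'D_w ('D_v F) q = 'D_v ('D_w F) q.
Proof.
move=> oO Oq sF.
have cvw : {for q, continuous ('D_w ('D_v F))}.
  by apply: (smooth_continuous _ Oq); do 2!apply: smooth_derive.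
have cwv : {for q, continuous ('D_v ('D_w F))}.
  by apply: (smooth_continuous _ Oq); do 2!apply: smooth_derive.
apply/eqP; rewrite -subr_eq0 -normr_eq0; apply/eqP; apply/le_anti.
rewrite normr_ge0 andbT; apply/ler_addgt0Pr => e e0; rewrite add0r.
have e20 : 0 < e / 2 by rewrite divr_gt0.
have : \forall x \near q, [/\ O x, `|'D_w ('D_v F) q - 'D_w ('D_v F) x| <= e / 2 &
   `|'D_v ('D_w F) q - 'D_v ('D_w F) x| <= e / 2].
  have Oq_near : nbhs q O by apply: open_nbhs_nbhs.
  have N2 : nbhs q [set x | `|'D_w ('D_v F) q - 'D_w ('D_v F) x| <= e / 2].
    by move/cvgrPdist_le : cvw => /(_ _ e20).
  have N3 : nbhs q [set x | `|'D_v ('D_w F) q - 'D_v ('D_w F) x| <= e / 2].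
    by move/cvgrPdist_le : cwv => /(_ _ e20).
  have FF : Filter (nbhs q) by exact: nbhs_filter.
  have N := @filterI _ _ FF _ _ Oq_near (@filterI _ _ FF _ _ N2 N3).
  by apply: (@filterS _ _ FF _ _ _ N) => x [Ox [B1 B2]]; exact: And3 Ox B1 B2.
move=> /nbhs_ballP[d /= d0 dP].
pose h := d / (`|v| + `|w| + 1).
have vw0 : 0 < `|v| + `|w| + 1 by rewrite ltr_wpDl// addr_ge0.
have h0 : 0 < h by rewrite divr_gt0.
have inball s t : 0 <= s <= h -> 0 <= t <= h -> ball q d (q + s *: v + t *: w).
  move=> /andP[s0 sh] /andP[t0 th].
  rewrite -ball_normE /ball_ /= -addrA opprD addNKr normrN.
  rewrite (le_lt_trans (ler_normD _ _))// !normrZ !ger0_norm//.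
  rewrite (@le_lt_trans _ _ (h * (`|v| + `|w|)))//.
    by rewrite mulrDr lerD// ler_wpM2r.
  by rewrite mulrAC ltr_pdivrMr// ltr_pM2l// ltrDl.
have dD v' x : O x -> differentiable F x /\ differentiable ('D_v' F) x.
  by move=> Ox; split; apply: (smooth_differentiable _ Ox) => //; exact: smooth_derive.
have [s [t [sh th E1]]] := second_difference_mvt (ltW h0)
  (fun s t sh th => let: And3 Ox _ _ := dP _ (inball s t sh th) in dD v _ Ox).
have inball' s1 t1 : 0 <= s1 <= h -> 0 <= t1 <= h ->
    ball q d (q + s1 *: w + t1 *: v).
  by move=> s1h t1h; rewrite addrAC; exact: inball.
have [t' [s' [th' sh' E2]]] := second_difference_mvt (ltW h0)
  (fun s t sh th => let: And3 Ox _ _ := dP _ (inball' s t sh th) in dD w _ Ox).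
have [_ B1 _] := dP _ (inball _ _ sh th).
have [_ _ B2] := dP _ (inball' _ _ th' sh').
have E : 'D_w ('D_v F) (q + s *: v + t *: w) = 'D_v ('D_w F) (q + t' *: w + s' *: v).
  apply: (@mulfI _ (h * h)); first by rewrite mulf_neq0// gt_eqF.
  apply: etrans (esym E1) (etrans _ E2).
  rewrite (addrAC q (h *: w)); congr (_ + _); exact: addrAC.
rewrite E in B1; rewrite [e]splitr.
rewrite -(subrKA ('D_v ('D_w F) (q + t' *: w + s' *: v))).
apply: le_trans (ler_normD _ _) _; apply: lerD; first exact: B1.
rewrite distrC; exact: B2.
Qed.

Lemma derive_pairE (R : realType) (W : normedModType R) (f : R * R -> W) q a b :
  differentiable f q ->
  'D_(a, b) f q = a *: 'D_(1, 0) f q + b *: 'D_(0, 1) f q.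
Proof.
move=> df; rewrite !(deriveE _ df).
have -> : ((a, b) : R * R) = a *: (1, 0) + b *: (0, 1).
  by apply/pair_equal_spec; split; rewrite /= ?scaler0 ?addr0 ?add0r ?[_ *: _]mulr1.
rewrite linearD; congr (_ + _); exact: linearZ.
Qed.

Section PlaneFields.
Context (R : realType) (O : set (R * R)).
Hypothesis oO : open O.
Implicit Types (f g F a b : R * R -> R) (q w : R * R).

Lemma smooth_deriveM f g q w : smooth_on O f -> smooth_on O g -> O q ->
  'D_w (fun x => f x * g x) q = f q * 'D_w g q + g q * 'D_w f q.
Proof.
by move=> sf sg Oq; apply: (@deriveM _ _ f g q w); apply: smooth_derivable Oq.
Qed.

Lemma smooth_deriveD f g q w : smooth_on O f -> smooth_on O g -> O q ->
  'D_w (fun x => f x + g x) q = 'D_w f q + 'D_w g q.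
Proof.
by move=> sf sg Oq; apply: (@deriveD _ _ _ f g q w); apply: smooth_derivable Oq.
Qed.

Lemma smooth_deriveN f q w : smooth_on O f -> O q ->
  'D_w (fun x => - f x) q = - 'D_w f q.
Proof.
by move=> sf Oq; apply: (@deriveN _ _ _ f q w); apply: smooth_derivable Oq.
Qed.

Lemma smooth_derive_cos f q w : smooth_on O f -> O q ->
  'D_w (fun x => cos (f x)) q = - sin (f q) * 'D_w f q.
Proof.
move=> sf Oq; have df := smooth_differentiable sf Oq.
by have [_] := differentiable_derive_comp w (is_derive_cos (f q)) df.
Qed.

Lemma smooth_derive_sin f q w : smooth_on O f -> O q ->
  'D_w (fun x => sin (f x)) q = cos (f q) * 'D_w f q.
Proof.
move=> sf Oq; have df := smooth_differentiable sf Oq.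
by have [_] := differentiable_derive_comp w (is_derive_sin (f q)) df.
Qed.

Lemma smooth_derive_pair f q (a b : R) : smooth_on O f -> O q ->
  'D_(a, b) f q = a * 'D_(1, 0) f q + b * 'D_(0, 1) f q.
Proof.
move=> sf Oq; rewrite (derive_pairE a b (smooth_differentiable sf Oq)).
by [].
Qed.

Lemma smooth_derive_field F a b :
  smooth_on O F -> smooth_on O a -> smooth_on O b ->
  smooth_on O (fun x => 'D_(a x, b x) F x).
Proof.
move=> sF sa sb.
apply: (@smooth_ext _ _ _ oO _ (fun x => a x * 'D_(1, 0) F x + b x * 'D_(0, 1) F x)).
  by move=> x Ox; exact: (esym (smooth_derive_pair _ _ sF Ox)).
have sD v : smooth_on O ('D_v F) := smooth_derive v sF.
exact: (smoothD oO (smoothM oO sa (sD _)) (smoothM oO sb (sD _))).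
Qed.

(** The commutator of two vector fields is the vector field whose components are
    the derivatives of the components; the second derivatives of [F] cancel by
    symmetry. *)
Lemma derive_bracket F a1 b1 a2 b2 q : O q -> smooth_on O F ->
  smooth_on O a1 -> smooth_on O b1 -> smooth_on O a2 -> smooth_on O b2 ->
  'D_(a1 q, b1 q) (fun x => 'D_(a2 x, b2 x) F x) q -
  'D_(a2 q, b2 q) (fun x => 'D_(a1 x, b1 x) F x) q =
  'D_('D_(a1 q, b1 q) a2 q - 'D_(a2 q, b2 q) a1 q,
      'D_(a1 q, b1 q) b2 q - 'D_(a2 q, b2 q) b1 q) F q.
Proof.
move=> Oq sF sa1 sb1 sa2 sb2.
have sD v : smooth_on O ('D_v F) := smooth_derive v sF.
have H a b w : smooth_on O a -> smooth_on O b ->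
    'D_w (fun x => 'D_(a x, b x) F x) q =
    a q * 'D_w ('D_(1, 0) F) q + 'D_(1, 0) F q * 'D_w a q +
    (b q * 'D_w ('D_(0, 1) F) q + 'D_(0, 1) F q * 'D_w b q).
  move=> sa sb.
  have E : \forall x \near q, 'D_(a x, b x) F x =
      a x * 'D_(1, 0) F x + b x * 'D_(0, 1) F x.
    by apply: (eq_on_near oO) Oq => x Ox; exact: smooth_derive_pair.
  rewrite (near_eq_derive _ E).
  rewrite (smooth_deriveD w (smoothM oO sa (sD _)) (smoothM oO sb (sD _)) Oq).
  by rewrite (smooth_deriveM w sa (sD _) Oq) (smooth_deriveM w sb (sD _) Oq).
rewrite (H _ _ _ sa2 sb2) (H _ _ _ sa1 sb1) [RHS](smooth_derive_pair _ _ sF Oq).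
have Fu (a b : R) := smooth_derive_pair a b (sD (1, 0)) Oq.
have Fv (a b : R) := smooth_derive_pair a b (sD (0, 1)) Oq.
rewrite (Fu (a1 q)) (Fu (a2 q)) (Fv (a1 q)) (Fv (a2 q)).
rewrite (derive_comm ((1, 0) : R * R) ((0, 1) : R * R) oO Oq sF).
move: ('D_(1, 0) ('D_(0, 1) F) q) ('D_(1, 0) ('D_(1, 0) F) q)
  ('D_(0, 1) ('D_(0, 1) F) q) ('D_(1, 0) F q) ('D_(0, 1) F q).
move: ('D_(a1 q, b1 q) a2 q) ('D_(a2 q, b2 q) a1 q) ('D_(a1 q, b1 q) b2 q)
  ('D_(a2 q, b2 q) b1 q) (a1 q) (a2 q) (b1 q) (b2 q) => *.
ring.
Qed.

End PlaneFields.

(** * Coordinates and frames of the Heisenberg group *)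

Section Coordinates.
Context (R : realType).
Implicit Types (p v w : 'rV[R]_3).

Lemma ord3P (P : 'I_3 -> Prop) : P 0 -> P 1 -> P 2 -> forall i, P i.
Proof.
move=> P0 P1 P2 [[|[|[|//]]] Hi].
- by rewrite (_ : Ordinal Hi = 0) //; exact: val_inj.
- by rewrite (_ : Ordinal Hi = 1) //; exact: val_inj.
- by rewrite (_ : Ordinal Hi = 2) //; exact: val_inj.
Qed.

Lemma row3P v w : v 0 0 = w 0 0 -> v 0 1 = w 0 1 -> v 0 2 = w 0 2 -> v = w.
Proof. by move=> h0 h1 h2; apply/rowP; apply: ord3P. Qed.

Lemma sum3E (V : zmodType) (F : 'I_3 -> V) : \sum_(i < 3) F i = F 0 + F 1 + F 2.
Proof.
rewrite !big_ord_recl big_ord0 addr0 addrA.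
by congr (F _ + F _ + F _); exact: val_inj.
Qed.

Lemma dVE p X Y Z : dV p X Y Z =
  th0 p X * (th1 p Y * th2 p Z - th1 p Z * th2 p Y)
  - th0 p Y * (th1 p X * th2 p Z - th1 p Z * th2 p X)
  + th0 p Z * (th1 p X * th2 p Y - th1 p Y * th2 p X).
Proof.
rewrite /dV (expand_det_row _ 0) sum3E /cofactor !(expand_det_row _ 0).
rewrite !big_ord_recl !big_ord0.
rewrite /cofactor !det_mx11 !mxE /=.
rewrite /coframe /bump /=.
rewrite !(expr0, expr1, expr2).
ring.
Qed.

End Coordinates.

Lemma row_combE (R : realType) (a b : R) (p q : 'rV[R]_3) i :
  (a *: p + b *: q) 0 i = a * p 0 i + b * q 0 i.
Proof. by rewrite !mxE. Qed.

Lemma th0_frame (R : realType) (p : 'rV[R]_3) (z0 z1 z2 : R) :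
  th0 p (z0 *: e0 p + z1 *: e1 p + z2 *: e2 p) = z0.
Proof. by rewrite /th0 !mxE /=; field. Qed.

Lemma th1_frame (R : realType) (p : 'rV[R]_3) (z0 z1 z2 : R) :
  th1 p (z0 *: e0 p + z1 *: e1 p + z2 *: e2 p) = z1.
Proof. by rewrite /th1 !mxE /=; ring. Qed.

Lemma th2_frame (R : realType) (p : 'rV[R]_3) (z0 z1 z2 : R) :
  th2 p (z0 *: e0 p + z1 *: e1 p + z2 *: e2 p) = z2.
Proof. by rewrite /th2 !mxE /=; ring. Qed.

(** The linear equations say that the covector (c, s, - a) vanishes on two tangent
    vectors (u, tu), (v, tv); Cramer's rule gives a, the rotation by (c, s) being
    invisible in the minor u0 v1 - u1 v0. *)
Lemma conormal_coef_alg (R : realType) (c s u0 u1 v0 v1 tu tv a : R) :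
  c * c + s * s = 1 -> c * u0 + s * u1 = a * tu -> c * v0 + s * v1 = a * tv ->
  a * ((- s * u0 + c * u1) * tv - (- s * v0 + c * v1) * tu) =
  - (u0 * v1 - u1 * v0).
Proof.
move=> cs Eu Ev.
transitivity ((- s * u0 + c * u1) * (a * tv) - (- s * v0 + c * v1) * (a * tu)).
  by ring.
by rewrite -Eu -Ev -[RHS]mul1r -cs; ring.
Qed.

(** The tangent vectors have angular speeds [a], [a'] and vertical speeds [- p],
    [- p'].  On the cylinder, the area form is the product of the angle form and
    the contact form, and the latter differs from dz by a multiple of the angle
    form. *)
Lemma cylinder_area_form (R : realType) (c s b a a' p p' : R) :
  c * c + s * s = 1 ->
  area_form cylinder_normal (vec3 c s b) (vec3 (- s * a) (c * a) (- p))
    (vec3 (- s * a') (c * a') (- p')) = p * a' - p' * a.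
Proof.
move=> cs; rewrite /area_form dVE /cylinder_normal /th0 /th1 /th2 !mxE /=.
transitivity ((c * c + s * s) * (p * a' - p' * a)); last by rewrite cs mul1r.
by field.
Qed.

(** * The adapted frame of the surface *)

Section ChartFormulas.
Context (R : realType) (S : set 'rV[R]_3) (atl : set (chart R)).
Context (f1 : 'rV[R]_3 -> 'rV[R]_3) (conormal : 'rV[R]_3 -> 'rV[R]_3 -> R).
Context (U : set 'rV[R]_3) (alpha : 'rV[R]_3 -> R).
Hypothesis hS : oriented_surface S atl.
Hypothesis hf1 : horizontal_unit_tangent atl S f1.
Hypothesis hor : area_positive atl (horizontal_normal f1).
Hypothesis hconormal : is_conormal atl S (horizontal_normal f1) conormal.
Hypothesis hU : rel_open S U.
Hypothesis halpha : smooth_along atl U alpha.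
Hypothesis heta : forall p, U p ->
  horizontal_normal f1 p = cos (alpha p) *: e1 p + sin (alpha p) *: e2 p.

Let eta := horizontal_normal f1.
Let A := coefA conormal.
Let f2 := second_field eta conormal.

Lemma U_sub_S p : U p -> S p.
Proof. by case: hU => V _ -> []. Qed.

Lemma frame_decomp (p y : 'rV[R]_3) :
  y = th1 p y *: e1 p + th2 p y *: e2 p + th0 p y *: e0 p.
Proof.
by apply: row3P; rewrite !mxE /= /th0 /th1 /th2; field.
Qed.

Lemma f1_horizontal_tangent p : S p -> th0 p (f1 p) = 0 /\ tangent atl p (f1 p).
Proof.
move=> Sp; have : [set v | exists t : R, v = t *: f1 p] (f1 p).
  by exists 1; rewrite scale1r.
by rewrite -(hut_span hf1 Sp) => -[].
Qed.

Lemma f1E p : U p -> f1 p = - sin (alpha p) *: e1 p + cos (alpha p) *: e2 p.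
Proof.
move=> Up; have [h0 _] := f1_horizontal_tangent (U_sub_S Up).
have /rowP E := heta Up; have := (E 0, E 1).
rewrite /horizontal_normal /J !mxE /= => -[E0 E1].
rewrite [LHS](frame_decomp p) h0 scale0r addr0; congr (_ *: _ + _ *: _); lra.
Qed.

Lemma conormalE p y : U p -> conormal p y =
  cos (alpha p) * th1 p y + sin (alpha p) * th2 p y - A p * th0 p y.
Proof.
move=> Up; have Sp := U_sub_S Up.
have lin := conormal_scalar hconormal Sp.
pose L := HB.pack_for {scalar 'rV[R]_3} (conormal p)
  (GRing.isLinear.Build _ _ _ _ _ lin).
have combE a b u v : conormal p (a *: u + b *: v) =
    a * conormal p u + b * conormal p v.
  have -> : conormal p = L by [].
  by rewrite linearD !linearZ.
have addE u v : conormal p (u + v) = conormal p u + conormal p v.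
  by have := combE 1 1 u v; rewrite !scale1r !mul1r.
have scaleE a u : conormal p (a *: u) = a * conormal p u.
  by have := combE a 0 u 0; rewrite !scale0r !mul0r !addr0.
have := conormal_eta hconormal Sp; rewrite heta// combE => E1.
have [_ /(conormal_tangent hconormal Sp)] := f1_horizontal_tangent Sp.
rewrite f1E// combE => E2.
rewrite {1}[y](frame_decomp p) addE combE scaleE /A /coefA.
move: E1 E2; have := cos2Dsin2 (alpha p).
move: (cos _) (sin _) (conormal p (e1 p)) (conormal p (e2 p)) (conormal p (e0 p)).
move=> c s l1 l2 l0 cs E1 E2.
have -> : l1 = c.
  rewrite -[l1]mul1r -cs.
  have -> : (c ^+ 2 + s ^+ 2) * l1 = c * (c * l1 + s * l2) - s * (- s * l1 + c * l2).
    by ring.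
  by rewrite E1 E2; ring.
have -> : l2 = s.
  rewrite -[l2]mul1r -cs.
  have -> : (c ^+ 2 + s ^+ 2) * l2 = s * (c * l1 + s * l2) + c * (- s * l1 + c * l2).
    by ring.
  by rewrite E1 E2; ring.
by ring.
Qed.

Lemma area_formE p X Y : U p -> area_form eta p X Y =
  (- sin (alpha p) * th1 p X + cos (alpha p) * th2 p X) * th0 p Y -
  (- sin (alpha p) * th1 p Y + cos (alpha p) * th2 p Y) * th0 p X.
Proof.
move=> Up; rewrite /area_form dVE.
have -> : th0 p (eta p) = 0.
  by rewrite /eta heta// /th0 !mxE /=; field.
have -> : th1 p (eta p) = cos (alpha p).
  by rewrite /eta heta// /th1 !mxE /=; ring.
have -> : th2 p (eta p) = sin (alpha p).
  by rewrite /eta heta// /th2 !mxE /=; ring.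
by ring.
Qed.

Lemma cos2_sin2 (t : R) : cos t * cos t + sin t * sin t = 1.
Proof. by rewrite -!expr2 cos2Dsin2. Qed.

(** * The surface in one chart *)

Section OneChart.
Context (phi : chart R) (aphi : atl phi).

(** The vectors [u], [v] are the coordinate fields; [tu], [tv] are their components
    along [e0], and [su], [sv] those along [f1], with respect to (e0, f1, eta).
    [N] is the density of the area form, [B] the expression of [A], and (a1, b1),
    (a2, b2) the components of [f1], [f2] on the coordinate fields, as given by
    Cramer's rule with determinant [N]. *)
Let Q := dom phi `&` phi @^-1` U.
Let u i (x : R * R) : R := 'D_(1, 0) (fun y : R * R => phi y 0 i : R) x.
Let v i (x : R * R) : R := 'D_(0, 1) (fun y : R * R => phi y 0 i : R) x.
Let al (x : R * R) : R := alpha (phi x).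
Let c (x : R * R) : R := cos (al x).
Let s (x : R * R) : R := sin (al x).
Let tu (x : R * R) : R := u 2 x + (phi x 0 1 * u 0 x - phi x 0 0 * u 1 x) / 2.
Let tv (x : R * R) : R := v 2 x + (phi x 0 1 * v 0 x - phi x 0 0 * v 1 x) / 2.
Let su (x : R * R) : R := - s x * u 0 x + c x * u 1 x.
Let sv (x : R * R) : R := - s x * v 0 x + c x * v 1 x.
Let N (x : R * R) : R := su x * tv x - sv x * tu x.
Let B (x : R * R) : R := - (u 0 x * v 1 x - u 1 x * v 0 x) / N x.
Let a1 (x : R * R) : R := tv x / N x.
Let b1 (x : R * R) : R := - tu x / N x.
Let a2 (x : R * R) : R := - sv x / N x.
Let b2 (x : R * R) : R := su x / N x.

Lemma open_Q : open Q.
Proof.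
case: hU => V oV UE; rewrite openE => x [dx Ux].
have cphi : {for x, continuous phi}.
  exact/differentiable_continuous/(chart_differentiable hS aphi dx).
have Vx : V (phi x) by move: Ux; rewrite /= UE => -[].
have V_near : \forall y \near x, V (phi y).
  by apply: cphi; apply: open_nbhs_nbhs.
have d_near : \forall y \near x, dom phi y.
  by apply: open_nbhs_nbhs; split=> //; exact: (chart_open hS aphi).
rewrite /interior /=; near=> y; split; first by near: y.
by rewrite /= UE; split; [apply: (chart_mem hS aphi) |]; near: y.
Unshelve. all: by end_near. Qed.

Lemma dphiE x w i : Q x -> ('D_w phi x) 0 i = 'D_w (fun y => phi y 0 i) x.
Proof.
move=> [dx _]; rewrite derive_mx ?mxE//.
by apply: diff_derivable; exact: (chart_differentiable hS aphi dx).
Qed.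

Lemma dphi_comb x a b i : Q x -> ('D_(a, b) phi x) 0 i = a * u i x + b * v i x.
Proof.
move=> [dx Ux].
have := derive_pairE a b (chart_differentiable hS aphi dx) => ->.
rewrite row_combE; congr (_ * _ + _ * _); exact: dphiE.
Qed.

Lemma du_entry x i : Q x -> du phi x 0 i = u i x.
Proof. by move=> Qx; exact: dphiE. Qed.

Lemma dv_entry x i : Q x -> dv phi x 0 i = v i x.
Proof. by move=> Qx; exact: dphiE. Qed.

Lemma th0_du x : Q x -> th0 (phi x) (du phi x) = tu x.
Proof. by move=> Qx; rewrite /th0 !(du_entry _ Qx). Qed.

Lemma th0_dv x : Q x -> th0 (phi x) (dv phi x) = tv x.
Proof. by move=> Qx; rewrite /th0 !(dv_entry _ Qx). Qed.

Lemma area_form_phi x : Q x -> area_form eta (phi x) (du phi x) (dv phi x) = N x.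
Proof.
move=> Qx; rewrite area_formE; last by case: Qx.
rewrite /N /su /sv -(th0_du Qx) -(th0_dv Qx) -!(du_entry _ Qx) -!(dv_entry _ Qx) /th1 /th2.
reflexivity.
Qed.

Lemma N_gt0 x : Q x -> 0 < N x.
Proof. by move=> Qx; rewrite -area_form_phi//; apply: hor => //; case: Qx. Qed.

Lemma N_neq0 x : Q x -> N x != 0.
Proof. by move=> /N_gt0; rewrite lt0r => /andP[]. Qed.

Lemma conormal_phi x w : Q x ->
  c x * ('D_w phi x) 0 0 + s x * ('D_w phi x) 0 1 = A (phi x) * th0 (phi x) ('D_w phi x).
Proof.
move=> [dx Ux]; apply/eqP; rewrite -subr_eq0 -conormalE//; apply/eqP.
by apply: (conormal_tangent hconormal (U_sub_S Ux)); exists phi, x, w.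
Qed.

Lemma conormal_u x : Q x -> c x * u 0 x + s x * u 1 x = A (phi x) * tu x.
Proof. by move=> Qx; rewrite -(th0_du Qx) -(conormal_phi _ Qx) -!(du_entry _ Qx). Qed.

Lemma conormal_v x : Q x -> c x * v 0 x + s x * v 1 x = A (phi x) * tv x.
Proof. by move=> Qx; rewrite -(th0_dv Qx) -(conormal_phi _ Qx) -!(dv_entry _ Qx). Qed.

Lemma cos_sin_phi x : c x * c x + s x * s x = 1.
Proof. exact: cos2_sin2. Qed.

Lemma coefA_phi x : Q x -> A (phi x) = B x.
Proof.
move=> Qx; have N0 := N_neq0 Qx; apply: (mulIf N0); rewrite /B divfK//.
exact: conormal_coef_alg (cos_sin_phi x) (conormal_u Qx) (conormal_v Qx).
Qed.

Lemma f1_coords x : Q x ->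
  [/\ f1 (phi x) 0 0 = - s x, f1 (phi x) 0 1 = c x & th0 (phi x) (f1 (phi x)) = 0].
Proof.
move=> [dx Ux]; rewrite f1E// /th0 !mxE /=.
by split; rewrite -/(al x) -/(s x) -/(c x); field.
Qed.

Lemma f2_coords x : Q x ->
  [/\ f2 (phi x) 0 0 = B x * c x, f2 (phi x) 0 1 = B x * s x
    & th0 (phi x) (f2 (phi x)) = 1].
Proof.
move=> Qx; rewrite -(coefA_phi Qx); case: Qx => dx Ux.
rewrite /f2 /second_field /eta heta// /th0 !mxE /=.
by split; rewrite -/(al x) -/(s x) -/(c x) -?/A; field.
Qed.

Lemma row3_th0P (p y z : 'rV[R]_3) : y 0 0 = z 0 0 -> y 0 1 = z 0 1 -> th0 p y = th0 p z ->
  y = z.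
Proof. by rewrite /th0 => E0 E1; rewrite E0 E1 => /addIr; exact: row3P. Qed.

Lemma f1_dphi x : Q x -> f1 (phi x) = 'D_(a1 x, b1 x) phi x.
Proof.
move=> Qx; have [F0 F1 F2] := f1_coords Qx; have N0 := N_neq0 Qx.
have := (conormal_u Qx, conormal_v Qx) => -[Eu Ev].
have E : c x * (tv x * u 0 x - tu x * v 0 x) + s x * (tv x * u 1 x - tu x * v 1 x) = 0.
  have -> : c x * (tv x * u 0 x - tu x * v 0 x) + s x * (tv x * u 1 x - tu x * v 1 x)
     = tv x * (c x * u 0 x + s x * u 1 x) - tu x * (c x * v 0 x + s x * v 1 x) by ring.
  by rewrite Eu Ev; ring.
apply: (@row3_th0P (phi x)).
- rewrite F0 dphi_comb//; apply: (mulIf N0).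
  rewrite /a1 /b1 mulrDl [X in X + _]mulrAC [X in _ + X]mulrAC !divfK//.
  have -> : tv x * u 0 x + - tu x * v 0 x =
      (c x * c x + s x * s x) * (tv x * u 0 x - tu x * v 0 x).
    by rewrite cos_sin_phi; ring.
  apply/eqP; rewrite -subr_eq0; apply/eqP.
  rewrite -[RHS](mulr0 (- c x)) -{}E /N /su /sv; ring.
- rewrite F1 dphi_comb//; apply: (mulIf N0).
  rewrite /a1 /b1 mulrDl [X in X + _]mulrAC [X in _ + X]mulrAC !divfK//.
  have -> : tv x * u 1 x + - tu x * v 1 x =
      (c x * c x + s x * s x) * (tv x * u 1 x - tu x * v 1 x).
    by rewrite cos_sin_phi; ring.
  apply/eqP; rewrite -subr_eq0; apply/eqP.
  rewrite -[RHS](mulr0 (- s x)) -{}E /N /su /sv; ring.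
- rewrite F2 /th0 !dphi_comb//; rewrite /a1 /b1 /tu /tv; field.
  exact: N0.
Qed.

Lemma f2_dphi x : Q x -> f2 (phi x) = 'D_(a2 x, b2 x) phi x.
Proof.
move=> Qx; have [F0 F1 F2] := f2_coords Qx; have N0 := N_neq0 Qx.
have BN : B x * N x = - (u 0 x * v 1 x - u 1 x * v 0 x) by rewrite /B divfK.
apply: (@row3_th0P (phi x)).
- rewrite F0 dphi_comb//; apply: (mulIf N0).
  rewrite /a2 /b2 mulrDl [X in X + _]mulrAC [X in _ + X]mulrAC !divfK//.
  by rewrite [LHS]mulrAC BN /su /sv; ring.
- rewrite F1 dphi_comb//; apply: (mulIf N0).
  rewrite /a2 /b2 mulrDl [X in X + _]mulrAC [X in _ + X]mulrAC !divfK//.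
  by rewrite [LHS]mulrAC BN /su /sv; ring.
- rewrite F2 /th0 !dphi_comb//; apply: (mulIf N0); rewrite mul1r.
  rewrite /a2 /b2 {1}/N /tu /tv; field.
  exact: N0.
Qed.

(** (f1, f2) has area 1, so its determinant on the coordinate fields is the inverse
    of their area. *)
Lemma frame_det x : Q x -> a1 x * b2 x - a2 x * b1 x = (N x)^-1.
Proof.
move=> Qx; have N0 := N_neq0 Qx; apply: (mulIf N0); apply: (mulIf N0).
rewrite mulVf// mul1r [in RHS]/N /a1 /b1 /a2 /b2; field; exact: N0.
Qed.

Lemma smooth_phi i : smooth_on Q (fun x => phi x 0 i).
Proof.
apply: (smooth_entry open_Q) => n; have := par_smooth (atlas_par hS aphi) n.
elim: n (par phi : R * R -> _) => [|n IH] f /=.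
  by move=> cf x [dx _]; exact: cf.
by move=> [df Df]; split=> [x [dx _]|w]; [exact: df | exact: IH].
Qed.

Lemma smooth_al : smooth_on Q al.
Proof. exact: (halpha aphi). Qed.

Lemma smooth_c : smooth_on Q c. Proof. exact: (smooth_cos open_Q smooth_al). Qed.
Lemma smooth_s : smooth_on Q s. Proof. exact: (smooth_sin open_Q smooth_al). Qed.
Lemma smooth_u i : smooth_on Q (u i). Proof. exact: (smooth_derive _ (smooth_phi i)). Qed.
Lemma smooth_v i : smooth_on Q (v i). Proof. exact: (smooth_derive _ (smooth_phi i)). Qed.

Lemma smooth_th0_comb (g : 'I_3 -> R * R -> R) : (forall i, smooth_on Q (g i)) ->
  smooth_on Q (fun x => g 2 x + (phi x 0 1 * g 0 x - phi x 0 0 * g 1 x) / 2).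
Proof.
move=> sg; have oQ := open_Q; have s2 : smooth_on Q (fun=> 2^-1 : R) by exact: smooth_cst.
apply: (smoothD oQ (sg 2)); apply: (smoothM oQ _ s2).
exact: (smoothB oQ (smoothM oQ (smooth_phi 1) (sg 0)) (smoothM oQ (smooth_phi 0) (sg 1))).
Qed.

Lemma smooth_tu : smooth_on Q tu. Proof. exact: (smooth_th0_comb smooth_u). Qed.
Lemma smooth_tv : smooth_on Q tv. Proof. exact: (smooth_th0_comb smooth_v). Qed.

Lemma smooth_f1_comb (g : 'I_3 -> R * R -> R) : (forall i, smooth_on Q (g i)) ->
  smooth_on Q (fun x => - s x * g 0 x + c x * g 1 x).
Proof.
move=> sg; have oQ := open_Q.
exact: (smoothD oQ (smoothM oQ (smoothN oQ smooth_s) (sg 0))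
  (smoothM oQ smooth_c (sg 1))).
Qed.

Lemma smooth_su : smooth_on Q su. Proof. exact: (smooth_f1_comb smooth_u). Qed.
Lemma smooth_sv : smooth_on Q sv. Proof. exact: (smooth_f1_comb smooth_v). Qed.

Lemma smooth_N : smooth_on Q N.
Proof.
exact: (smoothB open_Q (smoothM open_Q smooth_su smooth_tv)
  (smoothM open_Q smooth_sv smooth_tu)).
Qed.

Lemma smooth_div_N (g : R * R -> R) : smooth_on Q g -> smooth_on Q (fun x => g x / N x).
Proof.
by move=> sg; apply: (smoothM open_Q sg); exact: (smoothV open_Q N_neq0 smooth_N).
Qed.

Lemma smooth_a1 : smooth_on Q a1. Proof. exact: (smooth_div_N smooth_tv). Qed.
Lemma smooth_b1 : smooth_on Q b1.
Proof. exact: (smooth_div_N (smoothN open_Q smooth_tu)). Qed.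
Lemma smooth_a2 : smooth_on Q a2.
Proof. exact: (smooth_div_N (smoothN open_Q smooth_sv)). Qed.
Lemma smooth_b2 : smooth_on Q b2. Proof. exact: (smooth_div_N smooth_su). Qed.
Lemma smooth_B : smooth_on Q B.
Proof.
apply: smooth_div_N; apply: (smoothN open_Q).
exact: (smoothB open_Q (smoothM open_Q (smooth_u 0) (smooth_v 1))
  (smoothM open_Q (smooth_u 1) (smooth_v 0))).
Qed.

(** * Derivatives along the surface and curvature *)

(** The equality [h (phi y) = g y] is what makes functions that are only known
    pointwise on the surface differentiable. *)
Lemma sdiff_phi (W : normedModType R) (h : 'rV[R]_3 -> W) (g : R * R -> W) x w :
  (forall y, Q y -> h (phi y) = g y) -> smooth_on Q g -> Q x ->
  sdiff atl h (phi x) ('D_w phi x) = 'D_w g x.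
Proof.
move=> hg sg Qx.
have gh y : Q y -> g y = (h \o phi) y by move=> Qy; rewrite /= hg.
have dh : differentiable (h \o phi) x.
  by apply: smooth_differentiable Qx; exact: (smooth_ext open_Q gh sg).
case: (Qx) => dx _; rewrite (sdiff_chart hS w aphi dx dh).
by apply: near_eq_derive; apply: (eq_on_near open_Q) Qx => y /gh.
Qed.

Lemma flat_nabla_phi X Z (z0 z1 z2 : R * R -> R) x w :
  (forall y, Q y -> [/\ th0 (phi y) (Z (phi y)) = z0 y,
     th1 (phi y) (Z (phi y)) = z1 y & th2 (phi y) (Z (phi y)) = z2 y]) ->
  smooth_on Q z0 -> smooth_on Q z1 -> smooth_on Q z2 ->
  Q x -> X (phi x) = 'D_w phi x ->
  flat_nabla atl X Z (phi x) =
  'D_w z0 x *: e0 (phi x) + 'D_w z1 x *: e1 (phi x) + 'D_w z2 x *: e2 (phi x).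
Proof.
move=> Zz sz0 sz1 sz2 Qx Xx; rewrite /flat_nabla sum3E Xx.
congr (_ *: _ + _ *: _ + _ *: _).
- by apply: sdiff_phi => // y /Zz[].
- by apply: sdiff_phi => // y /Zz[].
- by apply: sdiff_phi => // y /Zz[].
Qed.

(** The horizontal vector with components (m, r) on (f1, eta) is projected to
    [m *: f1]. *)
Lemma tangential_part x (m r : R) (V : 'rV[R]_3) : Q x ->
  V = 0 *: e0 (phi x) + (- s x * m + c x * r) *: e1 (phi x)
      + (c x * m + s x * r) *: e2 (phi x) ->
  V - conormal (phi x) V *: eta (phi x) = m *: f1 (phi x).
Proof.
move=> [dx Ux] ->.
rewrite conormalE// th0_frame th1_frame th2_frame /eta heta// f1E//.
have -> : cos (alpha (phi x)) = c x by [].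
have -> : sin (alpha (phi x)) = s x by [].
have -> : c x * (- s x * m + c x * r) + s x * (c x * m + s x * r) - A (phi x) * 0 = r.
  by rewrite -[RHS]mul1r -(cos_sin_phi x); ring.
move: (c x) (s x) (e0 _) (e1 _) (e2 _) => c' s' E0 E1 E2.
apply/rowP => i; rewrite !mxE; ring.
Qed.

(** [f1] is parallel: differentiating it rotates it into a multiple of [eta], which
    the projection removes. *)
Lemma nabla_horizontal_phi X Z (h : R * R -> R) x w :
  (forall y, Q y -> Z (phi y) = h y *: f1 (phi y)) -> smooth_on Q h ->
  Q x -> X (phi x) = 'D_w phi x ->
  nabla atl eta conormal X Z (phi x) = 'D_w h x *: f1 (phi x).
Proof.
move=> Zh sh Qx Xx.
have oQ := open_Q.
have s0 : smooth_on Q (fun=> 0 : R) by exact: smooth_cst.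
have s1 := smoothN oQ (smoothM oQ sh smooth_s).
have s2 := smoothM oQ sh smooth_c.
have Zc y : Q y -> [/\ th0 (phi y) (Z (phi y)) = 0,
    th1 (phi y) (Z (phi y)) = - (h y * s y) & th2 (phi y) (Z (phi y)) = h y * c y].
  move=> Qy; have [F0 F1 F2] := f1_coords Qy; rewrite Zh// /th1 /th2 !mxE F0 F1.
  split; [|ring|by []].
  move: F2; rewrite /th0 !mxE => F2; rewrite -[RHS](mulr0 (h y)) -F2; ring.
rewrite /nabla (flat_nabla_phi Zc s0 s1 s2 Qx Xx).
apply: (@tangential_part _ _ (- h x * 'D_w al x)) => //.
have -> : 'D_w (fun=> 0 : R) x = 0 by exact: derive_cst.
congr (_ + _ *: _ + _ *: _).
  rewrite (smooth_deriveN w (smoothM oQ sh smooth_s) Qx) (smooth_deriveM w sh smooth_s Qx).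
  by rewrite (smooth_derive_sin w smooth_al Qx) -/(c x); ring.
rewrite (smooth_deriveM w sh smooth_c Qx) (smooth_derive_cos w smooth_al Qx) -/(s x); ring.
Qed.

(** The term [dA] multiplies [eta] and is removed by the projection; what remains
    is the rotation of [eta] in the direction of [f1]. *)
Lemma nabla_f2_phi X x w : Q x -> X (phi x) = 'D_w phi x ->
  nabla atl eta conormal X f2 (phi x) = (B x * 'D_w al x) *: f1 (phi x).
Proof.
move=> Qx Xx.
have oQ := open_Q.
have s0 : smooth_on Q (fun=> 1 : R) by exact: smooth_cst.
have s1 := smoothM oQ smooth_B smooth_c.
have s2 := smoothM oQ smooth_B smooth_s.
have Zc y : Q y -> [/\ th0 (phi y) (f2 (phi y)) = 1,
    th1 (phi y) (f2 (phi y)) = B y * c y & th2 (phi y) (f2 (phi y)) = B y * s y].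
  by move=> /f2_coords[].
rewrite /nabla (flat_nabla_phi Zc s0 s1 s2 Qx Xx).
apply: (@tangential_part _ _ ('D_w B x)) => //.
have -> : 'D_w (fun=> 1 : R) x = 0 by exact: derive_cst.
congr (_ + _ *: _ + _ *: _).
  rewrite (smooth_deriveM w smooth_B smooth_c Qx).
  rewrite (smooth_derive_cos w smooth_al Qx) -/(s x); ring.
rewrite (smooth_deriveM w smooth_B smooth_s Qx).
rewrite (smooth_derive_sin w smooth_al Qx) -/(c x); ring.
Qed.

Lemma smooth_dal (a b : R * R -> R) : smooth_on Q a -> smooth_on Q b ->
  smooth_on Q (fun y => 'D_(a y, b y) al y).
Proof. exact: (smooth_derive_field open_Q smooth_al). Qed.

Lemma sdiff_field (Z : 'rV[R]_3 -> 'rV[R]_3) (a b : R * R -> R) x w :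
  smooth_on Q a -> smooth_on Q b ->
  (forall y, Q y -> Z (phi y) = 'D_(a y, b y) phi y) -> Q x ->
  sdiff atl Z (phi x) ('D_w phi x) =
  \row_i 'D_w (fun y : R * R => 'D_(a y, b y) (fun z : R * R => phi z 0 i : R) y : R) x.
Proof.
move=> sa sb ZE Qx; have oQ := open_Q.
pose g i (y : R * R) : R := 'D_(a y, b y) (fun z : R * R => phi z 0 i : R) y.
have sg i : smooth_on Q (g i) := smooth_derive_field oQ (smooth_phi i) sa sb.
have Zg y : Q y -> Z (phi y) = \row_i g i y.
  by move=> Qy; rewrite ZE//; apply/rowP => i; rewrite mxE; exact: dphiE.
rewrite (sdiff_phi w Zg (smooth_row oQ sg) Qx) derive_row// => i.
exact: smooth_differentiable (sg i) Qx.
Qed.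

(** Each coordinate of [lie_bracket] is the commutator of the two fields applied to
    that coordinate of the chart. *)
Lemma lie_bracket_phi x : Q x ->
  lie_bracket atl f1 f2 (phi x) =
  'D_('D_(a1 x, b1 x) a2 x - 'D_(a2 x, b2 x) a1 x,
      'D_(a1 x, b1 x) b2 x - 'D_(a2 x, b2 x) b1 x) phi x.
Proof.
move=> Qx; rewrite /lie_bracket (f1_dphi Qx) (f2_dphi Qx).
rewrite (sdiff_field _ smooth_a2 smooth_b2 f2_dphi Qx).
rewrite (sdiff_field _ smooth_a1 smooth_b1 f1_dphi Qx).
apply/rowP => i; rewrite mxE [X in _ + X]mxE [X in X - _]mxE [X in _ - X]mxE.
rewrite [RHS]dphiE//.
exact: (derive_bracket open_Q Qx (smooth_phi i) smooth_a1 smooth_b1 smooth_a2 smooth_b2).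
Qed.

(** The value of dA /\ dalpha on (f1, f2). *)
Let kappa (x : R * R) : R := 'D_(a1 x, b1 x) B x * 'D_(a2 x, b2 x) al x
             - 'D_(a2 x, b2 x) B x * 'D_(a1 x, b1 x) al x.

(** This is d(b dalpha) = db /\ dalpha on two vector fields: [d1], [d2] are the
    derivatives of alpha, [d12], [d21] the second derivatives in both orders, and
    [dw] the derivative along the bracket. *)
Lemma leibniz_bracket_alg (b d1b d2b d1 d2 d12 d21 dw P2 P1 : R) :
  P2 = b * d12 + d2 * d1b -> P1 = b * d21 + d1 * d2b -> d12 - d21 = dw ->
  P2 - P1 - b * dw = d1b * d2 - d2b * d1.
Proof. by move=> -> -> <-; ring. Qed.

(** Change of basis for a product of two covectors, [n] being the inverse of the
    determinant. *)
Lemma wedge_det_alg (p q p' q' a b a' b' n : R) : n != 0 ->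
  p * q' - p' * q = n^-1 ->
  ((p * a + q * b) * (p' * a' + q' * b') - (p' * a + q' * b) * (p * a' + q * b')) * n =
  a * b' - b * a'.
Proof.
move=> n0 E.
transitivity ((p * q' - p' * q) * (a * b' - b * a') * n); first by ring.
by rewrite E mulrAC mulVf// mul1r.
Qed.

Lemma curvature_phi x : Q x ->
  curvature atl eta conormal f1 f2 f2 (phi x) = kappa x *: f1 (phi x).
Proof.
move=> Qx; have oQ := open_Q.
have s1 := smoothM oQ smooth_B (smooth_dal smooth_a1 smooth_b1).
have s2 := smoothM oQ smooth_B (smooth_dal smooth_a2 smooth_b2).
rewrite /curvature.
rewrite (nabla_f2_phi Qx (lie_bracket_phi Qx)).
rewrite (@nabla_horizontal_phi f1 _ _ _ _
  (fun y Qy => nabla_f2_phi Qy (f2_dphi Qy)) s2 Qx (f1_dphi Qx)).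
rewrite (@nabla_horizontal_phi f2 _ _ _ _
  (fun y Qy => nabla_f2_phi Qy (f1_dphi Qy)) s1 Qx (f2_dphi Qx)).
rewrite -!scalerBl.
have E2 := smooth_deriveM (a1 x, b1 x) smooth_B (smooth_dal smooth_a2 smooth_b2) Qx.
have E1 := smooth_deriveM (a2 x, b2 x) smooth_B (smooth_dal smooth_a1 smooth_b1) Qx.
have E3 := derive_bracket oQ Qx smooth_al smooth_a1 smooth_b1 smooth_a2 smooth_b2.
apply: (f_equal (fun r => r *: f1 (phi x))).
apply: (leibniz_bracket_alg E2 E1 E3).
Qed.

Lemma hdot_curvature_phi x : Q x ->
  hdot (phi x) (curvature atl eta conormal f1 f2 f2 (phi x)) (f1 (phi x)) = kappa x.
Proof.
move=> Qx; rewrite curvature_phi//; case: (Qx) => dx /U_sub_S/(hut_unit hf1).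
rewrite /hdot /th1 /th2 !mxE => E.
by rewrite -[RHS]mulr1 -E; ring.
Qed.

Lemma sdiff_A_phi x w : Q x -> sdiff atl A (phi x) ('D_w phi x) = 'D_w B x.
Proof. exact: (sdiff_phi w coefA_phi smooth_B). Qed.

Lemma sdiff_alpha_phi x w : Q x -> sdiff atl alpha (phi x) ('D_w phi x) = 'D_w al x.
Proof. by apply: (sdiff_phi w _ smooth_al). Qed.

Lemma wedge_phi x : Q x ->
  wedge (sdiff atl A (phi x)) (sdiff atl alpha (phi x)) (f1 (phi x)) (f2 (phi x))
  = kappa x.
Proof.
move=> Qx; rewrite /wedge (f1_dphi Qx) (f2_dphi Qx).
congr (_ * _ - _ * _).
- exact: (sdiff_A_phi _ Qx).
- exact: (sdiff_alpha_phi _ Qx).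
- exact: (sdiff_A_phi _ Qx).
- exact: (sdiff_alpha_phi _ Qx).
Qed.

Lemma smooth_kappa : smooth_on Q kappa.
Proof.
have oQ := open_Q.
have sD a b := smooth_derive_field oQ smooth_B (a := a) (b := b).
exact: (smoothB oQ (smoothM oQ (sD _ _ smooth_a1 smooth_b1)
  (smooth_dal smooth_a2 smooth_b2))
  (smoothM oQ (sD _ _ smooth_a2 smooth_b2) (smooth_dal smooth_a1 smooth_b1))).
Qed.

Lemma gauss_map_phi x : Q x ->
  gauss_map conormal (phi x) = vec3 (c x) (s x) (- B x).
Proof.
move=> Qx; rewrite -(coefA_phi Qx); case: (Qx) => dx Ux.
rewrite /gauss_map !conormalE// /th0 /th1 /th2 !mxE /= -/(c x) -/(s x).
by congr vec3; field.
Qed.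

Lemma sdiff_gauss_map_phi x w : Q x ->
  sdiff atl (gauss_map conormal) (phi x) ('D_w phi x) =
  vec3 (- s x * 'D_w al x) (c x * 'D_w al x) (- 'D_w B x).
Proof.
move=> Qx; have oQ := open_Q.
pose g (i : 'I_3) y : R := [:: c y; s y; - B y]`_i.
have sg i : smooth_on Q (g i).
  by move: i; apply: ord3P; [exact: smooth_c | exact: smooth_s |
    exact: (smoothN oQ smooth_B)].
rewrite (sdiff_phi w gauss_map_phi (smooth_row oQ sg) Qx).
rewrite (@derive_row _ _ _ g); last first.
  by move=> i; exact: smooth_differentiable (sg i) Qx.
apply: row3P; rewrite !mxE /g /=.
- exact: (smooth_derive_cos w smooth_al Qx).
- exact: (smooth_derive_sin w smooth_al Qx).
- exact: (smooth_deriveN w smooth_B Qx).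
Qed.

(** Both sides are the determinant of (dA, dalpha) on the coordinate fields: on the
    left by the form of the Gauss map, on the right because changing from (f1, f2)
    to the coordinate fields multiplies it by [N]. *)
Lemma gauss_area_phi x : Q x ->
  gauss_area_form atl conormal (phi x) (du phi x) (dv phi x) = kappa x * N x.
Proof.
move=> Qx; have N0 := N_neq0 Qx.
have KN : kappa x * N x = 'D_(1, 0) B x * 'D_(0, 1) al x - 'D_(0, 1) B x * 'D_(1, 0) al x.
  rewrite /kappa.
  rewrite (smooth_derive_pair (a1 x) (b1 x) smooth_B Qx).
  rewrite (smooth_derive_pair (a2 x) (b2 x) smooth_B Qx).
  rewrite (smooth_derive_pair (a1 x) (b1 x) smooth_al Qx).
  rewrite (smooth_derive_pair (a2 x) (b2 x) smooth_al Qx).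
  exact: (wedge_det_alg _ _ _ _ N0 (frame_det Qx)).
have gu : sdiff atl (gauss_map conormal) (phi x) (du phi x) =
    vec3 (- s x * 'D_(1, 0) al x) (c x * 'D_(1, 0) al x) (- 'D_(1, 0) B x).
  exact: (sdiff_gauss_map_phi _ Qx).
have gv : sdiff atl (gauss_map conormal) (phi x) (dv phi x) =
    vec3 (- s x * 'D_(0, 1) al x) (c x * 'D_(0, 1) al x) (- 'D_(0, 1) B x).
  exact: (sdiff_gauss_map_phi _ Qx).
rewrite KN /gauss_area_form gu gv (gauss_map_phi Qx).
exact: (cylinder_area_form _ _ _ _ _ (cos_sin_phi x)).
Qed.

(** Once [W] lies in the image of a small open set [V] of the chart domain, both
    integrals are taken over a neighbourhood of [x] contained in [V], by
    injectivity of the chart. *)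
Lemma gaussian_ratio_cvg x : Q x ->
  chart_integral phi W (gauss_area_form atl conormal) /
  chart_integral phi W (area_form eta)
    @[W --> shrinking_nbhds atl S (phi x)] --> kappa x.
Proof.
move=> Qx; have oQ := open_Q; have [dx Ux] := Qx.
have PW : ProperFilter (within S (nbhs (phi x))).
  split; last by apply: within_filter; exact: nbhs_filter.
  by move=> /nbhs_singleton; apply; exact: (chart_mem hS aphi dx).
have PF := powerset_filter_from_filter PW.
have FF : Filter (shrinking_nbhds atl S (phi x)) by exact: within_filter.
apply/cvgrPdist_le => e e0.
have [V [oV Vx VQ Vratio]] := ratio_integrals_near oQ Qx
  (fun y Qy => smooth_continuous smooth_kappa Qy)
  (fun y Qy => smooth_continuous smooth_N Qy)
  N_gt0 e0.
have P := atlas_par hS aphi.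
have [V' oV' VE] := par_open P oV (fun y Vy => proj1 (VQ y Vy)).
have nbhs_image : within S (nbhs (phi x)) (phi @` V).
  have : nbhs (phi x) V'.
    apply: open_nbhs_nbhs; split=> //.
    by have : (phi @` V) (phi x) by [exists x]; rewrite VE => -[].
  by apply: filterS => y V'y Sy; rewrite VE.
have := powerset_filter_fromP nbhs_image.
apply: filterS => W [nW WV] [WS mW].
pose W' := dom phi `&` phi @^-1` W.
have W'V : W' `<=` V.
  move=> y [dy /WV[z Vz zy]].
  have <- : z = y; last by [].
  by apply: (par_inj P); rewrite ?inE//; have [] := VQ z Vz.
have gE : chart_integral phi W (gauss_area_form atl conormal) =
    (\int[(@lebesgue_measure R \x @lebesgue_measure R)%E]_(y in W') (kappa y * N y))%R.
  apply: eq_Rintegral => y; rewrite inE => /W'V/VQ Qy; exact: gauss_area_phi.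
have aE : chart_integral phi W (area_form eta) =
    (\int[(@lebesgue_measure R \x @lebesgue_measure R)%E]_(y in W') N y)%R.
  apply: eq_Rintegral => y; rewrite inE => /W'V/VQ Qy; exact: area_form_phi.
rewrite gE aE; apply: Vratio => //; first exact: mW.
have cphi : {for x, continuous phi}.
  exact/differentiable_continuous/(chart_differentiable hS aphi dx).
have d_near : nbhs x (dom phi).
  by apply: open_nbhs_nbhs; split=> //; exact: (chart_open hS aphi).
apply: filterS (filterI d_near (cphi _ nW)) => y [dy Wy]; split=> //.
exact: Wy (chart_mem hS aphi dy).
Qed.

End OneChart.

Lemma gaussian_curvature_formula p : U p ->
  is_gaussian_curvature atl S eta conormal p
    (hdot p (curvature atl eta conormal f1 f2 f2 p) (f1 p)) /\
  hdot p (curvature atl eta conormal f1 f2 f2 p) (f1 p) =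
  wedge (sdiff atl A p) (sdiff atl alpha p) (f1 p) (f2 p).
Proof.
move=> Up; split.
  move=> phi aphi [q dq qp]; subst p.
  rewrite (hdot_curvature_phi aphi (conj dq Up)).
  exact: (gaussian_ratio_cvg aphi (conj dq Up)).
have [phi aphi [q dq qp]] := atlas_cover hS (U_sub_S Up); subst p.
by rewrite (hdot_curvature_phi aphi (conj dq Up)) (wedge_phi aphi (conj dq Up)).
Qed.

End ChartFormulas.

Theorem proposition5p4 (R : realType) (S : set 'rV[R]_3) (atl : set (chart R))
    (f1 : 'rV[R]_3 -> 'rV[R]_3) (conormal : 'rV[R]_3 -> 'rV[R]_3 -> R)
    (U : set 'rV[R]_3) (alpha : 'rV[R]_3 -> R)
    (hS : oriented_surface S atl)
    (hT : forall p, S p -> tangent atl p <> horizontal p)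
    (hf1 : horizontal_unit_tangent atl S f1)
    (hor : area_positive atl (horizontal_normal f1))
    (hconormal : is_conormal atl S (horizontal_normal f1) conormal)
    (hU : rel_open S U)
    (halpha : smooth_along atl U alpha)
    (heta : forall p, U p ->
       horizontal_normal f1 p = cos (alpha p) *: e1 p + sin (alpha p) *: e2 p) :
  let eta := horizontal_normal f1 in
  let f2 := second_field eta conormal in
  let k := fun p => hdot p (curvature atl eta conormal f1 f2 f2 p) (f1 p) in
  forall p, U p ->
    is_gaussian_curvature atl S eta conormal p (k p) /\
    k p = wedge (sdiff atl (coefA conormal) p) (sdiff atl alpha p) (f1 p) (f2 p).
Proof. move=> eta f2 k p; exact: gaussian_curvature_formula. Qed.
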